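(* Let $\Gamma'\subset\Gamma$ be elliptic graphs, $\Gamma'$ a proper connected full subgraph of $\Gamma$, such that every vertex of $\partial_\Gamma(\Gamma')$ is an end-vertex of $\Gamma'$. Let $i=i_{(\Gamma',\Gamma)}$ be the index of the extension. Then the extension $\Gamma'\subset\Gamma$ is good if and only if $$\mathcal F_{i}P_0^{\Gamma}(\mathbf t_{\Gamma'})=P_0^{\Gamma'}(\mathbf t),$$ where $\mathcal F_iP_0^\Gamma(\mathbf t_{\Gamma'})$ denotes $\mathcal F_iP_0^\Gamma(\mathbf t)$ with $t_v=1$ substituted for all $v\notin\mathcal V(\Gamma')$.
   Context: For a decorated tree $G$ (vertex set $\mathcal V(G)$, integer decorations $e_v$, genera zero, negative definite intersection form on $L(G)=\mathbb Z\langle E_v\rangle$ with $(E_v,E_v)=e_v$, $(E_v,E_w)=1$ for adjacent $v\ne w$, $0$ otherwise), let $L'(G)$ be the dual lattice $\{l'\in L(G)\otimes\mathbb Q:(l',L(G))\subset\mathbb Z\}$, $[l']$ the class in $L'(G)/L(G)$, $E_v^*$ defined by $(E_v^*,E_w)=-\delta_{vw}$, $\delta_v$ the valency, $E^G=\sum E_v$, $Z_K^G$ defined by $(Z_K^G,E_v)=e_v+2$, $\chi(l')=-(l',l'-Z_K^G)/2$. Orders: $\ge$ coordinatewise, $\prec$ strictly smaller in every coordinate, $l>0$ if $l\ge0,l\ne0$; $|l'|$ the support. $\mathcal S'(G)=\{l':(l',E_v)\le0\ \forall v\}$, $s_h=\min\{l'\in\mathcal S'(G):[l']=h\}$, $Z_{min}(B)$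 the minimal nonzero element of $\mathcal S'(B)\cap L(B)$ for a connected full subgraph $B$. The Poincaré series $Z^G(\mathbf t)=\sum z^G(l')\mathbf t^{l'}$ is the Taylor expansion at $0$ of $\prod_v(1-\mathbf t^{E_v^*})^{\delta_v-2}$; the canonical polynomial is $P_0^G(\mathbf t)=\sum_{\ell\in L(G),\ell\not\prec0}w^G(\ell)\mathbf t^\ell$, $w^G(\ell)=z^G(Z_K^G-E^G-\ell)$, with support $Supp(P_0^G)=\{\ell\not\prec0:w^G(\ell)\ne0\}$. $G$ is an elliptic graph if $e_v\le-2$ for all $v$ and $\min_{l\in L(G),l>0}\chi(l)=0$. Its NN-elliptic sequence: $B^G_{-1}=G$, $Z_{B_{-1}}=s_{[Z_K^G]}$, $B^G_0=|Z^G_K-s_{[Z^G_K]}|$; for $j\ge0$, $Z_{B_j}=Z_{min}(B^G_j)$ and, if $Z^G_K-\sum_{i=-1}^jZ_{B_i}\ne0$, $B^G_{j+1}=|Z^G_K-\sum_{i=-1}^jZ_{B_i}|$; $m$ is the index with $Z_K^G=\sum_{i=-1}^mZ_{B_i}$. For $\Gamma'\subset\Gamma$: $\partial_\Gamma(\Gamma')$ is the set of vertices of $\Gamma'$ adjacent to some vertex of $\Gamma\setminus\Gamma'$; an end-vertex of $\Gamma'$ is a vertex of valency 1 in $\Gamma'$. It is known that there is a unique integer $i_{(\Gamma',\Gamma)}\ge0$ (index of the extension) with $B^\Gamma_{i}\subseteq\Gamma'\subsetneq B^\Gamma_{i-1}$, $i=i_{(\Gamma',\Gamma)}$. The extension is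 good if for every $\ell'\in Supp(P_0^{\Gamma'})$ there exists $\ell\in Supp(P_0^\Gamma)$ with $\ell|_{\Gamma'}=\ell'$ (restriction of coefficients to vertices of $\Gamma'$). For $i\ge0$ the truncated polynomial is $\mathcal F_iP_0^\Gamma(\mathbf t)=\sum w^\Gamma(\ell)\mathbf t^\ell$ over those $\ell\in Supp(P_0^\Gamma)$ with $\ell_v<0$ for all $v\in\mathcal V(\Gamma)\setminus\mathcal V(B^\Gamma_i)$. *)

(* Defs.v *)
From HB Require Import structures.
From mathcomp Require Import all_boot all_order all_algebra.
From mathcomp Require Import classical_sets fsbigop.
Set Implicit Arguments.
Unset Strict Implicit.
Unset Printing Implicit Defensive.
Import Order.TTheory GRing.Theory Num.Theory.
Local Open Scope ring_scope.

(* A decorated graph on the vertex type 'I_n is given by a (symmetric,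
   irreflexive) adjacency relation [adj] and integer decorations [e].
   Subgraphs are full subgraphs, given by their vertex sets S : {set 'I_n}.
   Lattice vectors (elements of L(S) (x) Q) are rational row vectors
   'rV[rat]_n, vanishing outside S. *)
Section EllipticGraphs.
Variable n : nat.
Variable adj : rel 'I_n.
Variable e : 'I_n -> int.

Definition vec := 'rV[rat]_n.
Definition co (x : vec) (v : 'I_n) : rat := x ord0 v.

Definition Ientry (v w : 'I_n) : rat :=
  if v == w then (e v)%:~R else if adj v w then 1 else 0.
Definition form (S : {set 'I_n}) (x y : vec) : rat :=
  \sum_(v in S) \sum_(w in S) co x v * co y w * Ientry v w.
Definition Evec (v : 'I_n) : vec := \row_w (if w == v then 1 else 0).

Definition inS (S : {set 'I_n}) (x : vec) : Prop :=
  forall v, v \notin S -> co x v = 0.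
Definition in_lattice (S : {set 'I_n}) (x : vec) : Prop :=
  inS S x /\ forall v, v \in S -> co x v \is a Num.int.
Definition in_dual (S : {set 'I_n}) (x : vec) : Prop :=
  inS S x /\ forall w, w \in S -> form S x (Evec w) \is a Num.int.

Definition neg_def (S : {set 'I_n}) : Prop :=
  forall x, inS S x -> x != 0 -> form S x x < 0.

Definition Estar (S : {set 'I_n}) (v : 'I_n) : vec :=
  xget 0 (fun x => inS S x /\
    forall w, w \in S -> form S x (Evec w) = - (v == w)%:R).
Definition ZK (S : {set 'I_n}) : vec :=
  xget 0 (fun x => inS S x /\
    forall v, v \in S -> form S x (Evec v) = (e v + 2)%:~R).
Definition EG (S : {set 'I_n}) : vec := \row_v (if v \in S then 1 else 0).
Definition valency (S : {set 'I_n}) (v : 'I_n) : nat := #|[set w in S | adj v w]|.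
Definition chi (S : {set 'I_n}) (x : vec) : rat := - form S x (x - ZK S) / 2.

Definition leS (S : {set 'I_n}) (x y : vec) : Prop :=
  forall v, v \in S -> co x v <= co y v.
Definition precb (S : {set 'I_n}) (x y : vec) : bool :=
  [forall v in S, co x v < co y v].
Definition gt0 (S : {set 'I_n}) (x : vec) : Prop := leS S 0 x /\ x != 0.
Definition supp (S : {set 'I_n}) (x : vec) : {set 'I_n} := [set v in S | co x v != 0].
Definition restr (V : {set 'I_n}) (x : vec) : vec :=
  \row_v (if v \in V then co x v else 0).

Definition Sprime (S : {set 'I_n}) (x : vec) : Prop :=
  in_dual S x /\ forall v, v \in S -> form S x (Evec v) <= 0.

Definition minimum (S : {set 'I_n}) (A : vec -> Prop) : vec :=
  xget 0 (fun x => A x /\ forall y, A y -> leS S x y).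
Definition s_ZK (S : {set 'I_n}) : vec :=
  minimum S (fun x => Sprime S x /\ in_lattice S (x - ZK S)).
Definition Zmin (B : {set 'I_n}) : vec :=
  minimum B (fun x => Sprime B x /\ in_lattice B x /\ x != 0).

(* NN-elliptic sequence of S:  Acc S j = sum_{i=-1}^{j-1} Z_{B_i},
   NNB S j = B_j (j >= 0), defined when NNdef S j holds *)
Fixpoint Acc (S : {set 'I_n}) (j : nat) : vec :=
  if j is j'.+1 then Acc S j' + Zmin (supp S (ZK S - Acc S j')) else s_ZK S.
Definition NNdef (S : {set 'I_n}) (j : nat) : bool := ZK S - Acc S j != 0.
Definition NNB (S : {set 'I_n}) (j : nat) : {set 'I_n} := supp S (ZK S - Acc S j).
Definition NNBprev (S : {set 'I_n}) (i : nat) : {set 'I_n} :=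
  if i is i'.+1 then NNB S i' else S.
Definition is_index (S V : {set 'I_n}) (i : nat) : Prop :=
  NNdef S i /\ NNB S i \subset V /\ V \proper NNBprev S i.

(* coefficient of x^k in (1 - x)^m *)
Definition cf (m : int) (k : nat) : int :=
  match m with
  | Posz p => (-1) ^+ k * ('C(p, k))%:Z
  | Negz q => ('C(q + k, k))%:Z   (* (1-x)^(-(q+1)) *)
  end.

(* z^S(l') : Taylor coefficient of prod_v (1 - t^{E_v^*})^{delta_v - 2} *)
Definition zcoef (S : {set 'I_n}) (l : vec) : rat :=
  \sum_(k \in (fun k : {ffun 'I_n -> nat} =>
        (forall v, v \notin S -> k v = 0) /\
        \sum_(v in S) ((k v)%:R : rat) *: Estar S v = l))
    \prod_(v in S) ((cf ((valency S v)%:Z - 2) (k v))%:~R : rat).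

Definition wcoef (S : {set 'I_n}) (l : vec) : rat := zcoef S (ZK S - EG S - l).
Definition inSupp (S : {set 'I_n}) (l : vec) : Prop :=
  in_lattice S l /\ ~~ precb S l 0 /\ wcoef S l != 0.

Definition good_ext (S V : {set 'I_n}) : Prop :=
  forall l', inSupp V l' -> exists l, inSupp S l /\ restr V l = l'.

(* coefficient of t^{l'} in F_i P_0^S(t_V) (t_v = 1 for v outside V) *)
Definition FiP0_sub_coef (S V : {set 'I_n}) (i : nat) (l' : vec) : rat :=
  \sum_(l \in (fun l : vec => inSupp S l /\
        (forall v, v \in S :\: NNB S i -> co l v < 0) /\ restr V l = l'))
    wcoef S l.
Definition P0_coef (V : {set 'I_n}) (l' : vec) : rat :=
  if precb V l' 0 then 0 else wcoef V l'.

Definition restr_rel (S : {set 'I_n}) : rel 'I_n :=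
  fun x y => [&& x \in S, y \in S & adj x y].
Definition connected (S : {set 'I_n}) : Prop :=
  forall v w, v \in S -> w \in S -> connect (restr_rel S) v w.
Definition is_tree (S : {set 'I_n}) : Prop :=
  (0 < #|S|)%N /\ connected S /\
  #|[set p : 'I_n * 'I_n | restr_rel S p.1 p.2]| = (#|S|.-1).*2.
Definition elliptic (S : {set 'I_n}) : Prop :=
  is_tree S /\ neg_def S /\ (forall v, v \in S -> e v <= -2) /\
  (forall l, in_lattice S l -> gt0 S l -> 0 <= chi S l) /\
  (exists l, in_lattice S l /\ gt0 S l /\ chi S l = 0).
Definition boundary (S V : {set 'I_n}) : {set 'I_n} :=
  [set v in V | [exists w in S :\: V, adj v w]].

End EllipticGraphs.

(* Main.v *)
(** If the truncated polynomial restricts to P_0 of V', every exponent of the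
    latter comes from a nonempty sum, so the extension is good.

    Conversely, put dg l v = (l, E_v).  As the E_v^* are linearly independent,
    w(l) is a product of local factors, the one at v being the coefficient of
    x^(delta_v - 2 + (l, E_v)) in (1 - x)^(delta_v - 2).  An exponent of the
    truncated polynomial is negative off V', and an end-vertex of V' with d
    neighbours outside V' then satisfies (l', E_v) >= 1; hence it restricts to
    an exponent of P_0 of V'.

    For an exponent l' of P_0 of V', minimality of Z_{B_{i-1}} (of s if i = 0)
    gives l'_v < 0 on V' \ B_i, so one has to show that the sum of w over all
    extensions of l' which are negative off V' is w(l').  The vertices outside
    V' are summed out one leaf u at a time.  With p the neighbour of u, the
    factor at u is the indicator of a condition on l_u, and the identity
    sum_{k <= N} [x^k] (1 - x)^(m + 1) = [x^N] (1 - x)^m lowers the valency of p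
    by one and shifts the exponent at p, provided the condition on l_u defines
    a ray l_u <= beta(l_p).  It does because the branches outside V' are so
    rational that Laufer's algorithm started at E_u on the branch never
    increases the coefficient of u: otherwise chi would vanish on a cycle that
    meets V' in at most one reduced vertex, whereas two nonzero effective cycles
    with chi = 0 always have a nonzero minimum with chi <= 0.  At the end only
    the shifts at the end-vertices of V' remain; they are trivial when
    l'_v >= -1, and otherwise the extension of l' provided by goodness shows
    that the shifted exponent is still nonnegative. *)
From mathcomp Require Import classical_sets fsbigop boolp.
From mathcomp Require Import all_boot all_order all_algebra.
From mathcomp Require Import zify ring lra.
Require Import Defs.
Set Implicit Arguments.
Unset Strict Implicit.
Unset Printing Implicit Defensive.
Import Order.TTheory GRing.Theory Num.Theory.
Local Open Scope ring_scope.

(** * Intersection numbers and consequences of negative definiteness *)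

Section IntersectionNumbers.
Variable n : nat.
Variable adj : rel 'I_n.
Variable e : 'I_n -> int.
Hypothesis adj_sym : symmetric adj.
Hypothesis adj_irr : irreflexive adj.

(* [dg x v] is the intersection number (x, E_v). *)
Definition dg (R : pzRingType) (x : 'I_n -> R) (v : 'I_n) : R :=
  (e v)%:~R * x v + \sum_(w | adj v w) x w.
(** The intersection form of the whole graph; the ring is a parameter because cycles are integral
    while [ZK] and [Estar] are rational. *)
Definition bil (R : pzRingType) (x y : 'I_n -> R) : R := \sum_v x v * dg y v.

Lemma bilC (R : comPzRingType) (x y : 'I_n -> R) : bil x y = bil y x.
Proof.
rewrite /bil /dg.
under eq_bigr do rewrite mulrDr.
under [RHS]eq_bigr do rewrite mulrDr.
rewrite !big_split /=; congr (_ + _).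
  by apply: eq_bigr => v _; rewrite mulrCA [RHS]mulrCA [x v * _]mulrC.
under eq_bigr do rewrite big_distrr /= big_mkcond.
under [RHS]eq_bigr do rewrite big_distrr /= big_mkcond.
rewrite exchange_big /=; apply: eq_bigr => v _; apply: eq_bigr => w _.
by rewrite adj_sym mulrC.
Qed.

Lemma eq_dg (R : pzRingType) (x y : 'I_n -> R) : x =1 y -> dg x =1 dg y.
Proof. by move=> xy v; rewrite /dg xy; congr (_ + _); apply: eq_bigr => w _. Qed.

Lemma dgD (R : pzRingType) (x y : 'I_n -> R) v :
  dg (fun w => x w + y w) v = dg x v + dg y v.
Proof. by rewrite /dg mulrDr big_split /= addrACA. Qed.

Lemma dgN (R : pzRingType) (x : 'I_n -> R) v : dg (fun w => - x w) v = - dg x v.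
Proof. by rewrite /dg mulrN sumrN opprD. Qed.

Lemma dgB (R : pzRingType) (x y : 'I_n -> R) v :
  dg (fun w => x w - y w) v = dg x v - dg y v.
Proof. by rewrite dgD dgN. Qed.

Lemma dgZ (R : comPzRingType) (c : R) (x : 'I_n -> R) v :
  dg (fun w => c * x w) v = c * dg x v.
Proof. by rewrite /dg mulrDr mulr_sumr mulrCA. Qed.

Lemma dg_intr (R : pzRingType) (x : 'I_n -> int) v :
  dg (fun w => (x w)%:~R) v = (dg x v)%:~R :> R.
Proof. by rewrite /dg rmorphD rmorphM /= intz rmorph_sum. Qed.

Lemma dg_basis (R : pzRingType) u v :
  dg (fun w => (w == u)%:R : R) v =
    (if v == u then (e v)%:~R else (adj v u)%:R).
Proof.
rewrite /dg; have -> : \sum_(w | adj v w) (w == u)%:R = (adj v u)%:R :> R.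
  case avu: (adj v u).
    by rewrite (bigD1 u) //= eqxx big1 ?addr0 // => w /andP[_ /negbTE->].
  by rewrite big1 // => w avw; case: eqP avw => // ->; rewrite avu.
case: eqP => [->|_]; first by rewrite adj_irr mulr1 addr0.
by rewrite mulr0 add0r; case: (adj v u).
Qed.

Lemma dg_ones (R : pzRingType) (v : 'I_n) (S : {set 'I_n}) : v \in S ->
  dg (fun w => (w \in S)%:R : R) v = (e v)%:~R + (valency adj S v)%:R.
Proof.
move=> vS; rewrite /dg vS mulr1 /valency; congr (_ + _).
rewrite -sum1_card natr_sum big_mkcond [RHS]big_mkcond; apply: eq_bigr => w _.
by rewrite inE; case: (adj v w) => //=; rewrite ?andbT ?andbF; case: (w \in S).
Qed.

Lemma dg_le_off (R : realDomainType) (x y : 'I_n -> R) v :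
  x v = y v -> (forall w, adj v w -> x w <= y w) -> dg x v <= dg y v.
Proof. by move=> xy le_xy; rewrite /dg xy lerD2l; apply: ler_sum. Qed.

Lemma dg_ge0_off (R : realDomainType) (x : 'I_n -> R) v :
  x v = 0 -> (forall w, 0 <= x w) -> 0 <= dg x v.
Proof. by move=> xv x0; rewrite /dg xv mulr0 add0r sumr_ge0. Qed.

Lemma bil_disjoint_ge0 (R : realDomainType) (x y : 'I_n -> R) :
  (forall v, 0 <= x v) -> (forall v, 0 <= y v) -> (forall v, x v * y v = 0) ->
  0 <= bil x y.
Proof.
move=> x0 y0 xy; apply: sumr_ge0 => v _.
have [->|xv] := eqVneq (x v) 0; first by rewrite mul0r.
apply: mulr_ge0 => //; apply: dg_ge0_off => //.
by have /eqP := xy v; rewrite mulf_eq0 (negbTE xv) => /eqP.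
Qed.

Notation T := [set: 'I_n].

Lemma dgE (x : 'I_n -> rat) v : dg x v = \sum_w x w * Ientry adj e w v.
Proof.
rewrite /dg [RHS](bigD1 v) //= /Ientry eqxx mulrC; congr (_ + _).
rewrite big_mkcond [RHS]big_mkcond; apply: eq_bigr => w _ /=.
rewrite adj_sym; case: eqP => [->|_]; first by rewrite adj_irr.
by case: adj; rewrite ?mulr1 ?mulr0.
Qed.

Lemma form_dg (S : {set 'I_n}) (x y : 'rV[rat]_n) : inS S x ->
  form adj e S x y = \sum_(v in S) co y v * dg (co x) v.
Proof.
move=> xS; rewrite /form exchange_big /=; apply: eq_bigr => w _.
rewrite dgE big_distrr /= big_mkcond /=; apply: eq_bigr => v _.
case: ifP => [_|/negbT/xS ->]; last by rewrite mul0r mulr0.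
by rewrite mulrAC mulrC mulrA.
Qed.

Lemma co_Evec u : co (@Evec n u) =1 (fun w => (w == u)%:R).
Proof. by move=> w; rewrite /co /Evec mxE; case: eqP. Qed.

Lemma form_Evec (S : {set 'I_n}) (x : 'rV[rat]_n) w : inS S x -> w \in S ->
  form adj e S x (Evec w) = dg (co x) w.
Proof.
move=> xS wS; rewrite form_dg // (bigD1 w) //= co_Evec eqxx mul1r big1 ?addr0 //.
by move=> v /andP[_ /negbTE vw]; rewrite co_Evec vw mul0r.
Qed.

Lemma form_bil (S : {set 'I_n}) (x y : 'rV[rat]_n) : inS S x -> inS S y ->
  form adj e S x y = bil (co x) (co y).
Proof.
move=> xS yS; rewrite form_dg // bilC /bil big_mkcond /=; apply: eq_bigr => v _.
by case: ifP => // /negbT/yS ->; rewrite mul0r.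
Qed.

Lemma inST (x : 'rV[rat]_n) : inS T x.
Proof. by move=> v; rewrite inE. Qed.

Hypothesis ndT : neg_def adj e T.

Lemma bil_lt0 (x : 'I_n -> rat) : (exists v, x v != 0) -> bil x x < 0.
Proof.
case=> v xv; pose y : 'rV[rat]_n := \row_w x w.
have yx : co y =1 x by move=> w; rewrite /co mxE.
have -> : bil x x = form adj e T y y.
  rewrite form_bil; try exact: inST.
  by rewrite /bil; apply: eq_bigr => w _; rewrite yx (eq_dg yx).
apply: ndT; first exact: inST.
by apply: contraNneq xv => y0; rewrite -yx y0 /co mxE.
Qed.

(** Write x = x+ - x-. Then (x-, x) <= 0, while (x-, x+) >= 0 because the supports are disjoint; so
    (x-, x-) >= 0 and negative definiteness gives x- = 0. *)
Lemma nef_ge0 (S : {set 'I_n}) (x : 'I_n -> rat) :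
  (forall v, v \notin S -> x v = 0) -> (forall v, v \in S -> dg x v <= 0) ->
  forall v, 0 <= x v.
Proof.
move=> xS nef.
pose xm v := Num.max (- x v) 0; pose xp v := Num.max (x v) 0.
have xE v : x v = xp v - xm v.
  rewrite /xp /xm; case: (lerP 0 (x v)) => h.
    by rewrite max_r ?oppr_le0 // subr0.
  by rewrite max_l ?oppr_ge0 ?ltW // sub0r opprK.
have xm0 v : 0 <= xm v by rewrite /xm le_max lexx orbT.
have xp0 v : 0 <= xp v by rewrite /xp le_max lexx orbT.
have le1 : bil xm x <= 0.
  apply: sumr_le0 => v _; case: (boolP (v \in S)) => vS.
    by apply: mulr_ge0_le0 => //; apply: nef.
  by rewrite /xm xS // oppr0 maxxx mul0r.
have ge1 : 0 <= bil xm xp.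
  apply: bil_disjoint_ge0 => // v; rewrite /xm /xp.
  case: (lerP 0 (x v)) => h.
    by rewrite (max_r _) ?oppr_le0 // mul0r.
  by rewrite mulr0.
have eq1 : bil xm x = bil xm xp - bil xm xm.
  rewrite /bil -sumrB; apply: eq_bigr => v _.
  by rewrite (eq_dg xE) dgB mulrBr.
move=> v; rewrite leNgt; apply/negP => xv.
have : bil xm xm < 0.
  by apply: bil_lt0; exists v; rewrite /xm max_l; lra.
by lra.
Qed.

Lemma nondegenerate (S : {set 'I_n}) (x : 'I_n -> rat) :
  (forall v, v \notin S -> x v = 0) -> (forall v, v \in S -> dg x v = 0) ->
  forall v, x v = 0.
Proof.
move=> xS x0 v; apply/eqP; rewrite eq_le; apply/andP; split; last first.
  by apply: (nef_ge0 xS) => w /x0 ->.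
rewrite -oppr_ge0; apply: (@nef_ge0 S (fun w => - x w)) => w wS.
  by rewrite xS ?oppr0.
by rewrite dgN x0 ?oppr0.
Qed.

Lemma dg_solvable (S : {set 'I_n}) (f : 'I_n -> rat) :
  exists x : 'rV[rat]_n, inS S x /\ forall v, v \in S -> dg (co x) v = f v.
Proof.
(* The columns outside [S] are those of the identity: x M records x off [S] and the intersection
   numbers on [S], and [nondegenerate] makes M invertible. *)
pose M : 'M[rat]_n := \matrix_(v, w)
  if w \in S then Ientry adj e v w else (v == w)%:R.
have ME (x : 'rV[rat]_n) w : (x *m M) ord0 w = if w \in S then dg (co x) w else co x w.
  rewrite !mxE; case: ifP => wS.
    by rewrite dgE; apply: eq_bigr => v _; rewrite mxE wS.
  rewrite (bigD1 w) //= mxE wS eqxx mulr1 big1 ?addr0 // => v /negbTE vw.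
  by rewrite mxE wS vw mulr0.
have Mfree : row_free M.
  apply/inj_row_free => x /rowP x0; apply/rowP => v.
  rewrite mxE; apply: (@nondegenerate S (co x)) => w wS.
    by have := x0 w; rewrite ME (negbTE wS) mxE.
  by have := x0 w; rewrite ME wS mxE.
rewrite row_free_unit in Mfree.
exists ((\row_w if w \in S then f w else 0) *m invmx M).
have xE w := ME ((\row_w if w \in S then f w else 0) *m invmx M) w.
split=> [w wS|w wS]; move: (xE w); rewrite mulmxKV // mxE.
  by rewrite (negbTE wS) => <-.
by rewrite wS.
Qed.

Lemma co_inj (x y : 'rV[rat]_n) : co x =1 co y -> x = y.
Proof. by move=> xy; apply/rowP => v; apply: xy. Qed.

Lemma coB (x y : 'rV[rat]_n) v : co (x - y) v = co x v - co y v.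
Proof. by rewrite /co !mxE. Qed.
Lemma coD (x y : 'rV[rat]_n) v : co (x + y) v = co x v + co y v.
Proof. by rewrite /co !mxE. Qed.
Lemma co0 v : co (0 : 'rV[rat]_n) v = 0.
Proof. by rewrite /co mxE. Qed.

Lemma dg_inj (S : {set 'I_n}) (x y : 'rV[rat]_n) : inS S x -> inS S y ->
  (forall v, v \in S -> dg (co x) v = dg (co y) v) -> x = y.
Proof.
move=> xS yS xy; apply: co_inj => v; apply/eqP; rewrite -subr_eq0; apply/eqP.
apply: (@nondegenerate S (fun v => co x v - co y v)) => w wS.
  by rewrite xS // yS // subrr.
by rewrite dgB xy ?subrr.
Qed.

Lemma ZK_spec (S : {set 'I_n}) :
  inS S (ZK adj e S) /\ forall v, v \in S -> dg (co (ZK adj e S)) v = (e v + 2)%:~R.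
Proof.
rewrite /ZK; case: (dg_solvable S (fun v => (e v + 2)%:~R)) => x [xS xE].
have [|h1 h2] := @xgetPex _ (0 : 'rV[rat]_n) (fun x => inS S x /\
    forall v, v \in S -> form adj e S x (Evec v) = (e v + 2)%:~R).
  by exists x; split=> // v vS; rewrite form_Evec // xE.
by split=> // v vS; rewrite -(form_Evec h1 vS) h2.
Qed.

Lemma Estar_spec (S : {set 'I_n}) u :
  inS S (Estar adj e S u) /\
  forall v, v \in S -> dg (co (Estar adj e S u)) v = - (u == v)%:R.
Proof.
rewrite /Estar; case: (dg_solvable S (fun v => - (u == v)%:R)) => x [xS xE].
have [|h1 h2] := @xgetPex _ (0 : 'rV[rat]_n) (fun x => inS S x /\
    forall v, v \in S -> form adj e S x (Evec v) = - (u == v)%:R).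
  by exists x; split=> // v vS; rewrite form_Evec // xE.
by split=> // v vS; rewrite -(form_Evec h1 vS) h2.
Qed.

(** Solve (x, E_v) = -1 on [S] over the rationals and clear denominators. Such a cycle bounds
    Laufer's algorithm from above, and later makes the thresholds finite. *)
Lemma strict_nef (S : {set 'I_n}) : exists Z : 'I_n -> int,
  [/\ forall v, 0 <= Z v, forall v, v \notin S -> Z v = 0 &
      forall v, v \in S -> @dg int Z v <= -1].
Proof.
have [x [xS xE]] := dg_solvable S (fun=> -1).
pose N : int := \prod_v denq (co x v).
have N0 : 0 < N by apply: prodr_gt0 => v _; apply: denq_gt0.
pose Z v : int := numq (co x v) * \prod_(w | w != v) denq (co x w).
have ZE v : (Z v)%:~R = N%:~R * co x v.
  by rewrite /N (bigD1 v) //= !intrM [RHS]mulrAC [_ * co x v]mulrC -numqE.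
have ZEd v : (dg Z v)%:~R = N%:~R * dg (co x) v.
  by rewrite -dgZ -dg_intr; apply: eq_dg.
exists Z; split=> v.
- rewrite -(ler_int rat) ZE mulr_ge0 ?ler0z ?(ltW N0) //.
  by apply: (@nef_ge0 S (co x)) => // w /xE ->; lra.
- by move=> vS; apply/eqP; rewrite -(eqr_int rat) ZE xS // mulr0.
- move=> vS; rewrite -(ler_int rat) ZEd xE //.
  have : 1 <= N%:~R :> rat by rewrite ler1z -gtz0_ge1.
  by lra.
Qed.

End IntersectionNumbers.

(** * Coefficients of (1 - x)^m, extended by zero to negative exponents *)

Definition cfz (m k : int) : int := if k is Posz j then cf m j else 0.

(** This is (1 - x)^(m+1) = (1 - x)^m - x (1 - x)^m, that is, Pascal's rule. The case m = -1 is
    separate because m + 1 then changes constructor in [cf]. *)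
Lemma cfzS (m k : int) : cfz (m + 1) k = cfz m k - cfz m (k - 1).
Proof.
case: k => [[|k]|k]; last by rewrite (_ : Negz k - 1 = Negz k.+1) /= ?subr0 //; lia.
  rewrite /= subr0 /cf; case: m => [p|[|q]] /=.
  - by rewrite !bin0.
  - by rewrite !bin0.
  - by rewrite !bin0.
rewrite (_ : Posz k.+1 - 1 = Posz k); last by lia.
case: m => [p|[|q]].
- by rewrite /= /cf addn1 binS PoszD exprS; ring.
- by rewrite /= /cf !add0n !binn bin0n mulr0.
- rewrite (_ : Negz q.+1 + 1 = Negz q) /= /cf; last by lia.
  have -> : (q.+1 + k.+1 = (q + k.+1).+1)%N by lia.
  have -> : (q.+1 + k = q + k.+1)%N by lia.
  by rewrite binS PoszD; ring.
Qed.

Lemma cfz_lt0 m k : k < 0 -> cfz m k = 0.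
Proof. by case: k. Qed.

Lemma cfzN1 k : cfz (-1) k = if 0 <= k then 1 else 0.
Proof. by case: k => [k|k] //=; rewrite /cf /= add0n binn. Qed.

(** The sum telescopes by [cfzS]; the bound on [N] makes the exponent of the remaining term
    negative. *)
Lemma sum_cfz (m K : int) (N : nat) : K < N%:Z ->
  \sum_(j < N) cfz (m + 1) (K - j%:Z) = cfz m K.
Proof.
move=> KN.
suff -> : \sum_(j < N) cfz (m + 1) (K - j%:Z) = cfz m K - cfz m (K - N%:Z).
  by rewrite [X in _ - X]cfz_lt0 ?subr0 //; lia.
elim: N {KN} => [|N IH]; first by rewrite big_ord0 subr0 subrr.
rewrite big_ord_recr /= IH cfzS (_ : K - N.+1%:Z = K - N%:Z - 1); first by ring.
by lia.
Qed.

(** * Product formula for the coefficients w *)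

Section CoefficientFormula.
Variable n : nat.
Variable adj : rel 'I_n.
Variable e : 'I_n -> int.
Hypothesis adj_sym : symmetric adj.
Hypothesis adj_irr : irreflexive adj.
Hypothesis ndT : neg_def adj e [set: 'I_n].

(** For l supported on [S], this is the coordinate at v of Z_K - E - l in the dual basis, since (Z_K
    - E, E_v) = 2 - delta_v. *)
Definition wexp (S : {set 'I_n}) (l : 'I_n -> int) (v : 'I_n) : int :=
  (valency adj S v)%:Z - 2 + dg adj e l v.
Definition wgt (S : {set 'I_n}) (l : 'I_n -> int) : int :=
  \prod_(v in S) cfz ((valency adj S v)%:Z - 2) (wexp S l v).

(* The E_v^* are linearly independent, so at most one exponent vector [k]
   contributes to [zcoef S (ZK - EG - x)], namely k_v = - (ZK - EG - x, E_v). *)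
Lemma wcoef_wgt (S : {set 'I_n}) (x : 'rV[rat]_n) (l : 'I_n -> int) :
  inS S x -> (forall v, co x v = (l v)%:~R) ->
  wcoef adj e S x = (wgt S l)%:~R.
Proof.
move=> xS xl.
have [ZKS ZKE] := ZK_spec adj_sym adj_irr ndT S.
set z := ZK adj e S - EG S - x.
have coEG v : co (EG S) v = (v \in S)%:R by rewrite /co /EG mxE; case: (v \in S).
have zS : inS S z.
  by move=> v vS; rewrite !coB ZKS // xS // coEG (negbTE vS) !subr0.
have zE v : v \in S -> dg adj e (co z) v = - (wexp S l v)%:~R.
  move=> vS.
  have -> : dg adj e (co z) v =
     dg adj e (co (ZK adj e S)) v - dg adj e (fun w => (w \in S)%:R) v
       - dg adj e (co x) v.
    by rewrite -!dgB; apply: eq_dg => w; rewrite !coB coEG.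
  rewrite ZKE // dg_ones // (eq_dg _ _ xl) dg_intr /wexp.
  by rewrite !rmorphD rmorphN /= ; ring.
pose P : set {ffun 'I_n -> nat} := fun k => (forall v, v \notin S -> k v = 0%N) /\
  \sum_(v in S) ((k v)%:R : rat) *: Estar adj e S v = z.
have sumE (k : {ffun 'I_n -> nat}) :
    let y := \sum_(v in S) ((k v)%:R : rat) *: Estar adj e S v in
    inS S y /\ forall w, w \in S -> dg adj e (co y) w = - (k w)%:R.
  move=> y.
  have yE w : co y w = \sum_(v in S) (k v)%:R * co (Estar adj e S v) w.
    by rewrite /co /y summxE; apply: eq_bigr => v _; rewrite mxE.
  split=> w wS.
    rewrite yE big1 // => v _.
    by have [-> //] := Estar_spec adj_sym adj_irr ndT S v; rewrite mulr0.
  have -> : dg adj e (co y) w =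
      \sum_(v in S) (k v)%:R * dg adj e (co (Estar adj e S v)) w.
    rewrite (eq_dg _ _ yE) dgE //.
    under eq_bigr do rewrite big_distrl /=.
    rewrite exchange_big /=; apply: eq_bigr => v _.
    by rewrite dgE // mulr_sumr; apply: eq_bigr => u _; rewrite mulrA.
  rewrite (bigD1 w) //= big1 ?addr0 => [|v /andP[vS /negbTE vw]].
    by have [_ ->] := Estar_spec adj_sym adj_irr ndT S w; rewrite ?eqxx // mulrN1.
  by have [_ ->] := Estar_spec adj_sym adj_irr ndT S v; rewrite ?vw // oppr0 mulr0.
have PK k : P k -> forall v, v \in S -> (k v)%:Z = wexp S l v.
  move=> [kS kz] v vS; have [_ h] := sumE k; have := h v vS.
  by rewrite kz zE // => /oppr_inj /eqP; rewrite pmulrn eqr_int eq_sym => /eqP.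
rewrite /wcoef /zcoef -/z -/P.
case: (boolP [forall v in S, 0 <= wexp S l v]) => [/forall_inP K0|].
  pose k0 : {ffun 'I_n -> nat} := [ffun v => if v \in S then `|wexp S l v|%N else 0%N].
  have k0E v : v \in S -> (k0 v)%:Z = wexp S l v.
    by move=> vS; rewrite ffunE vS gez0_abs // K0.
  have Pk0 : P k0.
    split=> [v /negbTE vS|]; first by rewrite ffunE vS.
    have [h1 h2] := sumE k0; apply: (dg_inj adj_sym adj_irr ndT h1 zS) => v vS.
    by rewrite h2 // zE // -k0E.
  have -> : P = [set k0]%classic.
    apply/seteqP; split=> k /=; last by move->.
    move=> Pk; apply/ffunP => v; case: (boolP (v \in S)) => vS.
      by apply/eqP; rewrite -eqz_nat PK // k0E.
    by rewrite ffunE (negbTE vS); case: Pk => ->.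
  rewrite fsbig_set1 /wgt rmorph_prod; apply: eq_bigr => v vS.
  by rewrite -k0E.
rewrite negb_forall => /existsP[v]; rewrite negb_imply -ltNge => /andP[vS vK].
have -> : P = classical_sets.set0.
  apply/seteqP; split=> k //= Pk.
  by have := PK k Pk v vS; lia.
by rewrite fsbig_set0 /wgt (bigD1 v) //= cfz_lt0 // mul0r.
Qed.

End CoefficientFormula.

(** * Cycles with chi = 0 and Laufer's algorithm *)

Section EllipticCycles.
Variable n : nat.
Variable adj : rel 'I_n.
Variable e : 'I_n -> int.
Hypothesis adj_sym : symmetric adj.
Hypothesis adj_irr : irreflexive adj.
Hypothesis ndT : neg_def adj e [set: 'I_n].
Hypothesis connT : connected adj [set: 'I_n].

Local Notation dgz := (@dg n adj e int).
Local Notation bil := (@bil n adj e int).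

Lemma connected_exit (P : pred 'I_n) x y : P x -> ~~ P y ->
  exists v w, [/\ P v, ~~ P w & adj v w].
Proof.
have /connectP[p] := connT (in_setT x) (in_setT y).
elim: p x => [|z p IH] x /=; first by move=> _ -> ->.
move=> /andP[/and3P[_ _ xz] zp] yl Px nPy.
case: (boolP (P z)) => Pz; first exact: IH zp yl Pz nPy.
by exists x, z.
Qed.

Definition basis_int (u w : 'I_n) : int := (w == u)%:R.

(* [chi2 f] is 2 chi(f). *)
Definition chi2 (f : 'I_n -> int) : int := \sum_v f v * (e v + 2 - dgz f v).

Lemma eq_chi2 f g : f =1 g -> chi2 f = chi2 g.
Proof. by move=> fg; apply: eq_bigr => v _; rewrite fg (eq_dg _ _ fg). Qed.

Lemma chi2D f g : chi2 (fun v => f v + g v) = chi2 f + chi2 g - 2 * bil f g.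
Proof.
have -> : 2 * bil f g = bil f g + bil g f.
  by rewrite (bilC e adj_sym g) mulr_natl mulr2n.
rewrite /chi2 /bil opprD !addrA -!big_split -!sumrB; apply: eq_bigr => v _ /=.
by rewrite dgD; ring.
Qed.

Lemma bil_basis f u : bil (basis_int u) f = dgz f u.
Proof.
rewrite /bil (bigD1 u) //= /basis_int eqxx mul1r big1 ?addr0 // => v /negbTE ->.
by rewrite mul0r.
Qed.

Lemma chi2_basis u : chi2 (basis_int u) = 2.
Proof.
rewrite /chi2 (bigD1 u) //= {1}/basis_int eqxx big1 ?addr0; last first.
  by move=> v /negbTE vu; rewrite {1}/basis_int vu mul0r.
by rewrite dg_basis // eqxx intz; lia.
Qed.

(** One step of a computation sequence: adding E_u does not increase chi as soon as (f, E_u) >=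
    1. *)
Lemma chi2_add_basis f u :
  chi2 (fun v => f v + basis_int u v) = chi2 f + 2 - 2 * dgz f u.
Proof. by rewrite chi2D chi2_basis (bilC e adj_sym) bil_basis. Qed.

Hypothesis chi2_ge0 : forall f : 'I_n -> int, (forall v, 0 <= f v) ->
  (exists v, f v != 0) -> 0 <= chi2 f.

(* If the supports are not adjacent, [f] can be enlarged by vertices next to its
   support without increasing chi, until it meets a neighbour of supp [g];
   then chi (f + g) < 0. *)
Lemma no_disjoint_chi2_le0 f g :
  (forall v, 0 <= f v) -> (forall v, 0 <= g v) ->
  (exists v, f v != 0) -> (exists v, g v != 0) ->
  (forall v, f v * g v = 0) -> chi2 f <= 0 -> chi2 g <= 0 -> False.
Proof.
move=> f0 g0 fn [y gy] fg cf cg.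
have [k] := ubnP #|[set v | f v == 0]|.
elim: k => // k IH in f f0 fn fg cf *; rewrite ltnS => leSk.
case: fn => x fx.
have bfg0 : 0 <= bil f g by apply: bil_disjoint_ge0.
(* From 0 <= chi (f + g) = chi f + chi g - (f, g); hence no vertex of supp g is adjacent to supp
   f. *)
have bfg : bil f g = 0.
  have := @chi2_ge0 (fun v => f v + g v) _ _.
  rewrite chi2D => h; suff: 0 <= chi2 f + chi2 g - 2 * bil f g by lia.
  apply: h => [v|]; first by rewrite addr_ge0.
  by exists x; have := f0 x; have := g0 x; lia.
have fdg v : g v != 0 -> dgz f v = 0.
  move=> gv; have fv : f v = 0.
    by have /eqP := fg v; rewrite mulf_eq0 (negbTE gv) orbF => /eqP.
  have d0 : 0 <= dgz f v by apply: dg_ge0_off.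
  move: bfg; rewrite (bilC e adj_sym) /bil => /eqP; rewrite psumr_eq0.
    by move=> /allP /(_ v (mem_index_enum v)) /=; rewrite mulf_eq0 (negbTE gv) => /eqP.
  move=> w _; have [->|gw] := eqVneq (g w) 0; first by rewrite mul0r.
  apply: mulr_ge0 => //; apply: dg_ge0_off => //.
  by have /eqP := fg w; rewrite mulf_eq0 (negbTE gw) orbF => /eqP.
have [v [w [fv fw vw]]] : exists v w, [/\ f v != 0, ~~ (f w != 0) & adj v w].
  apply: (@connected_exit (fun v => f v != 0) x y) => //.
  by have /eqP := fg y; rewrite mulf_eq0 (negbTE gy) orbF negbK.
have {}fw : f w = 0 by apply/eqP; rewrite -[_ == _]negbK.
have d1 : 1 <= dgz f w.
  rewrite /dg fw mulr0 add0r (bigD1 v) /=; last by rewrite adj_sym.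
  by rewrite ler_wpDr ?sumr_ge0 //; have := f0 v; lia.
(* As (f, E_w) >= 1, the vertex w is outside supp g by [fdg]; so adding E_w to f keeps the supports
   disjoint and does not increase chi. *)
have gw : g w = 0 by case: (eqVneq (g w) 0) => // /fdg; lia.
apply: (IH (fun v => f v + basis_int w v)).
- by move=> u; rewrite addr_ge0 // /basis_int; case: eqP.
- by exists v; rewrite /basis_int; have := f0 v; case: eqP; lia.
- by move=> u; rewrite mulrDl fg /basis_int; case: eqP => [->|_]; rewrite ?gw; lia.
- by rewrite chi2_add_basis; lia.
- apply: leq_trans leSk; apply: proper_card; apply/properP; split.
    apply/fintype.subsetP => u; rewrite !inE /basis_int; have := f0 u.
    by case: (u == w) => /=; lia.
  exists w; first by rewrite inE fw.
  by rewrite inE fw /basis_int eqxx.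
Qed.

(** The minimum m is nonzero by [no_disjoint_chi2_le0]. With M = f + g - m the maximum, chi m + chi
    M = chi f + chi g - (f - m, g - m); the pairing is nonnegative because f - m and g - m have
    disjoint supports, and chi M >= 0. *)
Lemma chi2_min_max f g :
  let m v := Num.min (f v) (g v) in
  (forall v, 0 <= f v) -> (forall v, 0 <= g v) ->
  (exists v, f v != 0) -> (exists v, g v != 0) ->
  chi2 f <= 0 -> chi2 g <= 0 -> (exists v, m v != 0) /\ chi2 m <= 0.
Proof.
move=> m f0 g0 fn gn cf cg.
case: (boolP [exists v, m v != 0]) => [/existsP mn|]; last first.
  rewrite negb_exists => /forallP m0; exfalso.
  apply: (no_disjoint_chi2_le0 f0 g0 fn gn _ cf cg) => v.
  have := m0 v; rewrite negbK /m => /eqP; have := f0 v; have := g0 v.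
  by case: (leP (f v) (g v)) => _ _ _ ->; rewrite ?mulr0 ?mul0r.
split=> //.
pose f' v := f v - m v; pose g' v := g v - m v.
have fE : f =1 (fun v => m v + f' v) by move=> v; rewrite /f'; lia.
have gE : g =1 (fun v => m v + g' v) by move=> v; rewrite /g'; lia.
pose M v := f v + g' v.
have M0 : 0 <= chi2 M.
  case: fn => x fx; apply: chi2_ge0 => [v|].
    by rewrite /M /g' /m; have := f0 v; have := g0 v; lia.
  by exists x; rewrite /M /g' /m; have := f0 x; have := g0 x; lia.
have b0 : 0 <= bil f' g'.
  by apply: bil_disjoint_ge0 => v; rewrite /f' /g' /m; case: (leP (f v) (g v)); lia.
have : chi2 m + chi2 M = chi2 f + chi2 g - 2 * bil f' g'.
  rewrite (chi2D f g') (eq_chi2 gE) (chi2D m g').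
  have -> : bil f g' = bil m g' + bil f' g'.
    rewrite /bil -big_split; apply: eq_bigr => v _ /=; rewrite -mulrDl; congr (_ * _).
    by rewrite /f'; lia.
  by ring.
by lia.
Qed.

(* Laufer's algorithm on the branch hanging at [u], started at E_u. If it had to
   increase the coefficient of [u], then chi (Delta + E_u + E_p) <= 0, although this
   cycle meets V' in at most the reduced vertex [p]. *)
Lemma nef_on_branch (V S : {set 'I_n}) (g : 'I_n -> int) u p :
  (forall v, 0 <= g v) -> (exists v, g v != 0) -> (forall v, v \notin V -> g v = 0) ->
  chi2 g <= 0 -> V \subset S -> u \notin S -> p \in S -> adj u p ->
  exists D : 'I_n -> int, [/\ forall v, 0 <= D v, D u = 1,
    forall v, v \in S -> D v = 0 & forall w, w \notin S -> dgz D w <= 0].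
Proof.
move=> g0 gn gV cg VS uS pS up.
pose R := ~: (u |: S).
have [Z [Z0 ZR Znef]] := strict_nef adj_sym adj_irr ndT R.
(* A ceiling for the algorithm: on [R] the inequality (Z, E_w) <= -1 absorbs a possible edge to u,
   so [D1] is anti-nef there. *)
pose D1 v := basis_int u v + Z v.
have b0 w v : 0 <= basis_int w v by rewrite /basis_int; case: eqP.
have uR : u \notin R by rewrite !inE eqxx.
have SR v : v \in S -> v \notin R by move=> vS; rewrite !inE vS orbT.
have Su v : v \in S -> v != u by apply: contraTneq => ->.
have D1nef w : w \in R -> dgz D1 w <= 0.
  move=> wR; rewrite dgD dg_basis //.
  have := Znef w wR; case: eqP => [wu|_]; first by rewrite wu (negbTE uR) in wR.
  by case: (adj w u); lia.
(* The number [k] bounds the distance left to the ceiling, and chi2 D <= 2 says chi D <= chi E_u =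
   1. *)
have main k : forall D : 'I_n -> int,
  (forall v, 0 <= D v <= D1 v) -> D u = 1 -> (forall v, v \in S -> D v = 0) ->
  chi2 D <= 2 -> \sum_v (D1 v - D v) < k%:Z ->
  exists D : 'I_n -> int, [/\ forall v, 0 <= D v, D u = 1,
    forall v, v \in S -> D v = 0, chi2 D <= 2 & forall w, w \in R -> dgz D w <= 0].
  elim: k => [|k IH] D D01 Du DS cD sD.
    have : 0 <= \sum_v (D1 v - D v).
      by apply: sumr_ge0 => v _; have := D01 v; lia.
    by move=> h; have := le_lt_trans h sD; rewrite ltxx.
  case: (boolP [forall w in R, dgz D w <= 0]) => [/forall_inP nefD|].
    by exists D; split=> // v; case/andP: (D01 v).
  rewrite negb_forall => /existsP[w]; rewrite negb_imply -ltNge => /andP[wR dw].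
  have wu : w != u by apply: contraTneq wR => ->.
  have Dw : D w < D1 w.
    have /andP[_] := D01 w; rewrite le_eqVlt => /orP[/eqP E|//].
    have : dgz D w <= dgz D1 w.
      by apply: dg_le_off => // v _; case/andP: (D01 v).
    by have := D1nef w wR; lia.
  apply: (IH (fun v => D v + basis_int w v)).
  - move=> v; have := D01 v; rewrite /basis_int; case: eqP => [->|_] /=; last by lia.
    by have := D01 w; lia.
  - by rewrite Du /basis_int eq_sym (negbTE wu).
  - move=> v vS; rewrite DS // /basis_int; case: eqP => // vw.
    by have := SR v vS; rewrite vw wR.
  - by rewrite chi2_add_basis; lia.
  - have -> : \sum_v (D1 v - (D v + basis_int w v)) = \sum_v (D1 v - D v) - 1.
      rewrite [X in _ - X](_ : 1 = \sum_v basis_int w v).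
        by rewrite -sumrB; apply: eq_bigr => v _; rewrite opprD addrA.
      rewrite (bigD1 w) //= /basis_int eqxx big1 ?addr0 // => v /negbTE vw.
      by rewrite vw.
    by lia.
have [|||||D [D0 Du DS cD Dnef]] := main `|(\sum_v (D1 v - basis_int u v) + 1)%R|%N (basis_int u).
- by move=> v; rewrite b0 /D1 lerDl Z0.
- by rewrite /basis_int eqxx.
- by move=> v /Su /negbTE vu; rewrite /basis_int vu.
- by rewrite chi2_basis.
- have : 0 <= \sum_v (D1 v - basis_int u v).
    by apply: sumr_ge0 => v _; rewrite /D1; have := Z0 v; lia.
  by lia.
exists D; split=> // w wS; case: (eqVneq w u) => [->|wu]; last first.
  by apply: Dnef; rewrite !inE negb_or wu.
rewrite leNgt; apply/negP => du.
(* If (D, E_u) >= 1, adding E_u keeps chi <= 1. Then (D + E_u, E_p) >= 2, so adding E_p gives chi <=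
   1 + 1 - 2 = 0. *)
pose l v := D v + basis_int u v + basis_int p v.
have dDp : 1 <= dgz D p.
  rewrite /dg DS // mulr0 add0r (bigD1 u) /=; last by rewrite adj_sym.
  by rewrite Du ler_wpDr ?sumr_ge0.
have cl : chi2 l <= 0.
  rewrite /l (chi2_add_basis (fun v => D v + basis_int u v)) chi2_add_basis dgD.
  rewrite dg_basis // (negbTE (Su p pS)) adj_sym up.
  by move: dDp du cD; lia.
have l0 v : 0 <= l v by rewrite /l !addr_ge0.
have [|[v mv] cm] := chi2_min_max l0 g0 _ gn cl cg.
  by exists u; rewrite /l Du /basis_int eqxx; case: (u == p).
(* On [V] the cycle [l] is at most E_p, and off [V] the cycle [g] is zero. So the nonzero minimum is
   E_p, whose chi is 1 and not <= 0. *)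
move: cm; rewrite (@eq_chi2 _ (basis_int p)) ?chi2_basis //.
have mE w' : w' != p -> Num.min (l w') (g w') = 0.
  move=> wp; case: (boolP (w' \in V)) => w'V.
    have w'S := fintype.subsetP VS _ w'V.
    have -> : l w' = 0 by rewrite /l DS // /basis_int (negbTE wp) (negbTE (Su _ w'S)).
    by rewrite min_l.
  by rewrite (gV w') // min_r.
move=> w'; rewrite /basis_int; case: eqP => [->|/eqP]; last exact: mE.
have vp : v = p by apply/eqP; apply: contraNT mv => /mE ->.
have lp : l p = 1 by rewrite /l DS // /basis_int (negbTE (Su p pS)) eqxx.
move: mv; rewrite vp lp; have := g0 p.
by case: (leP 1 (g p)) => //=; lia.
Qed.

(** * Edge counts in trees: [deg_sum] is twice the number of edges *)

Definition deg_sum (S : {set 'I_n}) : nat := \sum_(v in S) valency adj S v.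

Lemma card_restr_rel (S : {set 'I_n}) :
  #|[set q : 'I_n * 'I_n | restr_rel adj S q.1 q.2]| = deg_sum S.
Proof.
rewrite -sum1_card /deg_sum.
under [RHS]eq_bigr do rewrite /valency -sum1_card.
rewrite pair_big_dep /=; apply: eq_bigl => q.
by rewrite !inE /restr_rel.
Qed.

Lemma valency_setU1 (S : {set 'I_n}) u v : u \notin S ->
  valency adj (u |: S) v = (valency adj S v + adj v u)%N.
Proof.
move=> uS; rewrite /valency; case avu: (adj v u).
  have -> : [set w in u |: S | adj v w] = u |: [set w in S | adj v w].
    by apply/setP => w; rewrite !inE; case: eqP => // ->; rewrite avu.
  by rewrite cardsU1 !inE (negbTE uS) addnC.
rewrite addn0; congr #|pred_of_set _|.
by apply/setP => w; rewrite !inE; case: (eqVneq w u) => [->|_] /=; rewrite ?avu ?andbF.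
Qed.

Lemma valencyE (S : {set 'I_n}) v : valency adj S v = (\sum_(w in S) adj v w)%N.
Proof.
rewrite /valency -sum1_card big_mkcond [RHS]big_mkcond; apply: eq_bigr => w _.
by rewrite inE; case: (w \in S) => //=; case: adj.
Qed.

Lemma deg_sum_setU1 (S : {set 'I_n}) u : u \notin S ->
  deg_sum (u |: S) = (deg_sum S + 2 * valency adj S u)%N.
Proof.
move=> uS; rewrite /deg_sum big_setU1 //= valency_setU1 // adj_irr addn0.
under eq_bigr do rewrite valency_setU1 //.
rewrite big_split /= [in RHS]valencyE.
under [X in (_ + (_ + X))%N]eq_bigr do rewrite adj_sym.
by rewrite [in LHS]valencyE mul2n -addnn addnCA.
Qed.

Lemma exists_neighbor (S : {set 'I_n}) : S != finset.set0 -> S != setT ->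
  exists2 u, u \notin S & (0 < valency adj S u)%N.
Proof.
case/set0Pn => x xS ST; have [y yS] : exists y, y \notin S.
  by apply/existsP; rewrite -negb_forall; apply: contra ST => /forallP h; apply/eqP/setP => y; rewrite h inE.
have [v [u [vS uS vu]]] := @connected_exit (mem S) x y xS yS.
exists u => //; rewrite card_gt0; apply/set0Pn; exists v.
by rewrite inE adj_sym vu andbT.
Qed.

(** By connectedness [S] grows to the whole graph through vertices adjacent to the current set, each
    bringing at least one new edge. *)
Lemma deg_sum_grow (S : {set 'I_n}) : S != finset.set0 ->
  (deg_sum S + 2 * n <= deg_sum setT + 2 * #|S|)%N.
Proof.
have [k] := ubnP #|~: S|; elim: k => // k IH in S *; rewrite ltnS => Sk S0.
have [->|ST] := eqVneq S setT; first by rewrite cardsT card_ord.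
have [u uS vu] := exists_neighbor S0 ST.
have := IH (u |: S); rewrite deg_sum_setU1 // cardsU1 uS.
have -> : (#|~: (u |: S)| < k)%N.
  apply: leq_trans Sk; apply: proper_card; apply/properP; split.
    by rewrite setCS finset.subsetUr.
  by exists u; rewrite ?inE // eqxx.
have -> : u |: S != finset.set0 by apply/set0Pn; exists u; rewrite !inE eqxx.
by move=> /(_ isT isT); lia.
Qed.

(** Any u outside [S] adjacent to [S] will do: [deg_sum_grow] for u |: S leaves room for a single
    edge between u and [S]. *)
Lemma exists_leaf (S : {set 'I_n}) : S != finset.set0 -> S != setT ->
  (deg_sum S + 2 = 2 * #|S|)%N -> (deg_sum setT + 2 = 2 * n)%N ->
  exists u p, [/\ u \notin S, p \in S, adj u p, forall w, w \in S -> adj u w -> w = p &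
    (deg_sum (u |: S) + 2 = 2 * #|u |: S|)%N].
Proof.
move=> S0 ST eS eT; have [u uS vu] := exists_neighbor S0 ST.
have U0 : u |: S != finset.set0 by apply/set0Pn; exists u; rewrite !inE eqxx.
have := deg_sum_grow U0; rewrite deg_sum_setU1 // cardsU1 uS => h.
have v1 : valency adj S u = 1%N by lia.
have /eqP/cards1P[p pE] := v1.
have pP w : (w \in S) && adj u w = (w == p).
  by have /setP/(_ w) := pE; rewrite !inE.
have /andP[pS up] : (p \in S) && adj u p by rewrite pP.
exists u, p; split=> //; last by rewrite deg_sum_setU1 // cardsU1 uS v1; lia.
by move=> w wS uw; apply/eqP; rewrite -pP wS.
Qed.

End EllipticCycles.

(** * Integer thresholds and truncated telescoping sums *)

Lemma int_threshold (P : int -> bool) (b0 b1 : int) :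
  (forall b, P b -> P (b - 1)) -> P b0 -> ~~ P b1 ->
  exists beta : int, forall b : int, P b = (b <= beta).
Proof.
move=> Pdown P0 P1.
have downN b (k : nat) : P b -> P (b - k%:Z).
  move=> Pb; elim: k => [|k /Pdown]; first by rewrite subr0.
  by rewrite (_ : b - k%:Z - 1 = b - k.+1%:Z) //; lia.
have le01 : b0 < b1.
  rewrite ltNge; apply: contra P1 => le10.
  by have := downN _ `|(b0 - b1)%R|%N P0; rewrite gez0_abs ?subr_ge0 // subKr.
have [k b1E] : exists k : nat, b1 = b0 + k%:Z.
  by exists `|(b1 - b0)%R|%N; rewrite gez0_abs; lia.
elim: k b1 P1 le01 b1E => [|k IH] b1 P1 le01 b1E; first by move: le01; rewrite b1E; lia.
case: (boolP (P (b1 - 1))) => Pb.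
  exists (b1 - 1) => b; apply/idP/idP => [Pb'|le_b].
    rewrite leNgt; apply: contra P1 => lt_b.
    have -> : b1 = b - `|(b - b1)%R|%N%:Z by rewrite gez0_abs; lia.
    exact: downN.
  have -> : b = (b1 - 1) - `|(b1 - 1 - b)%R|%N%:Z by rewrite gez0_abs; lia.
  exact: downN.
apply: (IH (b1 - 1)) => //; last by lia.
have : b1 - 1 != b0 by apply: contraNneq Pb => ->.
by lia.
Qed.

(** This is [sum_cfz] after shifting the index by [j0]. If [j0] exceeds [N], the sum has no nonzero
    term and K < 0. *)
Lemma sum_cfz_tail (m K : int) (j0 N : nat) : K + j0%:Z < N%:Z ->
  \sum_(j < N) (if (j0 <= j)%N then cfz (m + 1) (K + j0%:Z - j%:Z) else 0) = cfz m K.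
Proof.
move=> KN; case: (leqP j0 N) => [le_jN|lt_Nj]; last first.
  rewrite cfz_lt0; last by lia.
  by rewrite big1 // => j _; rewrite leqNgt (ltn_trans (ltn_ord j) lt_Nj).
rewrite -(big_mkord xpredT (fun j => if (j0 <= j)%N then cfz (m + 1) (K + j0%:Z - j%:Z) else 0)).
rewrite (@big_cat_nat _ _ _ j0) //= big_nat_cond big1 ?add0r; last first.
  by move=> j /andP[/andP[_ lt_j] _]; rewrite leqNgt lt_j.
rewrite -{1}[j0]add0n big_addn big_mkord.
rewrite -(@sum_cfz m K (N - j0)); last by lia.
by apply: eq_bigr => j _; rewrite leq_addl; congr cfz; lia.
Qed.

(** * Summing out the vertices outside V *)

Section Summation.
Variable n : nat.
Variable adj : rel 'I_n.
Variable e : 'I_n -> int.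
Hypothesis adj_sym : symmetric adj.
Hypothesis adj_irr : irreflexive adj.
Variable V : {set 'I_n}.

Local Notation dgz := (@dg n adj e int).
Local Notation val S v := ((valency adj S v)%:Z).
Local Notation vect := {ffun 'I_n -> int}.
Local Notation weight l := (wgt adj e [set: 'I_n] (l : {ffun 'I_n -> int})).

(** The list carries the finiteness of the set of nonzero terms, on which the value of a finitely
    supported sum depends. *)
Definition has_sum (A : vect -> Prop) (s : int) : Prop :=
  exists r : seq vect, [/\ uniq r, forall l, l \in r <-> A l /\ weight l != 0 &
    \sum_(l <- r) weight l = s].

Lemma has_sum_equiv (A B : vect -> Prop) (s : int) :
  (forall l, weight l != 0 -> A l <-> B l) -> has_sum A s -> has_sum B s.
Proof.
move=> AB [r [ur rA sr]]; exists r; split=> // l; rewrite rA.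
by split=> -[h w0]; split=> //; apply/(AB l w0).
Qed.

Lemma has_sum_fibers (A : vect -> Prop) (f : vect -> int) (N : nat) (s : nat -> int) :
  (forall j, (j < N)%N -> has_sum (fun l => A l /\ f l = -1 - j%:Z) (s j)) ->
  (forall l, A l -> weight l != 0 -> exists2 j, (j < N)%N & f l = -1 - j%:Z) ->
  has_sum A (\sum_(j < N) s j).
Proof.
move=> sj Aj.
suff : has_sum (fun l => A l /\ exists2 j, (j < N)%N & f l = -1 - j%:Z) (\sum_(j < N) s j).
  apply: has_sum_equiv => l w0; split=> [[]//|Al]; split=> //; exact: Aj.
elim: N {Aj} sj => [|N IH] sj.
  rewrite big_ord0; exists [::]; split=> // [l|]; last by rewrite big_nil.
  by split=> // -[[_ [j]]].
have [|r1 [u1 r1A s1]] := IH; first by move=> j jN; apply: sj; apply: ltnW.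
have [r2 [u2 r2A s2]] := sj N (ltnSn N).
exists (r1 ++ r2); split.
- rewrite cat_uniq u1 u2 andbT /=; apply/hasPn => l /r2A[[_ fl] _].
  by apply/negP => /r1A[[_ [j jN]]]; rewrite fl; lia.
- move=> l; rewrite mem_cat; split=> [/orP[/r1A[[Al [j jN fl]] w0]|/r2A[[Al fl] w0]]|].
  + by split=> //; split=> //; exists j => //; apply: ltnW.
  + by split=> //; split=> //; exists N.
  + move=> [[Al [j]]]; rewrite ltnS leq_eqVlt => /orP[/eqP ->|jN] fl w0.
      by apply/orP; right; apply/r2A.
    by apply/orP; left; apply/r1A; split=> //; split=> //; exists j.
- by rewrite big_cat big_ord_recr /= s1 s2.
Qed.

Definition dg_in (S : {set 'I_n}) (l : vect) v : int :=
  e v * l v + \sum_(w in S | adj v w) l w.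

Definition shifted_wgt (S : {set 'I_n}) (tau : 'I_n -> int -> int) (l : vect) : int :=
  \prod_(v in S) cfz (val S v - 2) (val S v - 2 + dg_in S l v + tau v (l v)).

Definition outer_sum (S : {set 'I_n}) v (f : 'I_n -> int) : int :=
  \sum_(j | (j \notin S) && adj v j) f j.

Definition extends (S : {set 'I_n}) (l0 l : vect) : Prop :=
  (forall v, v \in S -> l v = l0 v) /\ (forall v, v \notin S -> l v < 0).

(* [tau] records the effect of summing out the coordinates outside [S]:
   the exponent of the factor at [v] is shifted by [tau v (l v)]. *)
Record summed_out (S : {set 'I_n}) (tau : 'I_n -> int -> int) : Prop := SummedOut {
  so_inner : forall v, v \in S -> (forall w, adj v w -> w \in S) ->
    forall a, tau v a = 0;
  so_zero : forall v a, v \in S -> -1 <= a -> a <= 0 \/ v \in V -> tau v a = 0;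
  so_mono : forall D : 'I_n -> int, (forall v, 0 <= D v) ->
    (forall w, w \notin S -> dgz D w <= 0) ->
    forall v b, v \in S ->
    tau v b - outer_sum S v D <= tau v (b - D v);
  so_max : forall l : 'I_n -> int,
    (forall w, w \notin S -> 2 - val [set: 'I_n] w <= dgz l w) ->
    forall v, v \in S -> v \notin V \/ l v <= 0 ->
    outer_sum S v (fun j => l j + 1) <= tau v (l v);
  so_sum : forall l0 : vect, (forall v, v \in S -> v \notin V -> l0 v < 0) ->
    has_sum (extends S l0) (shifted_wgt S tau l0) }.

Lemma dg_inT l v : dg_in [set: 'I_n] l v = dgz l v.
Proof.
rewrite /dg_in /dg intz; congr (_ + _).
by apply: eq_bigl => w; rewrite inE.
Qed.

Lemma summed_outT : summed_out [set: 'I_n] (fun _ _ => 0).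
Proof.
split=> // [D _ _ v b _|l _ v _ _|l0 _].
- by rewrite /outer_sum big1 ?subr0 // => j; rewrite inE.
- by rewrite /outer_sum big1 // => j; rewrite inE.
have -> : shifted_wgt [set: 'I_n] (fun _ _ => 0) l0 = weight l0.
  by apply: eq_bigr => v _; rewrite addr0 dg_inT.
have ext1 l : extends [set: 'I_n] l0 l <-> l = l0.
  split=> [[h _]|->]; last by split=> // v; rewrite inE.
  by apply/ffunP => v; apply: h; rewrite inE.
have [w0|w0] := eqVneq (weight l0) 0.
  rewrite w0; exists [::]; split=> // [l|]; last by rewrite big_nil.
  by split=> [//|[/ext1->]]; rewrite w0 eqxx.
exists [:: l0]; split=> // [l|]; last by rewrite big_seq1.
by rewrite inE; split=> [/eqP -> //|[/ext1 -> //]]; split=> //; apply/ext1.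
Qed.

Lemma dg_split (S : {set 'I_n}) (l : vect) v :
  dgz l v = dg_in S l v + outer_sum S v l.
Proof.
rewrite /dg /dg_in intz -addrA; congr (_ + _).
rewrite (bigID (mem S)) /=; congr (_ + _); apply: eq_bigl => w; exact: andbC.
Qed.

Lemma valency_split (S : {set 'I_n}) v :
  val [set: 'I_n] v = val S v + outer_sum S v (fun=> 1).
Proof.
rewrite !valencyE -!natz !natr_sum /= (bigID (mem S)) /=; congr (_ + _).
  by apply: eq_bigl => w; rewrite inE.
rewrite big_mkcond [RHS]big_mkcond; apply: eq_bigr => w _; rewrite inE /=.
by case: (w \in S) => //=; case: adj.
Qed.

Lemma valencyT v : val [set: 'I_n] v = \sum_(w | adj v w) 1.
Proof.
rewrite valencyE -natz natr_sum /= big_mkcond [RHS]big_mkcond.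
by apply: eq_bigr => w _; rewrite inE; case: adj.
Qed.

Lemma outer_sumD S v (f g : 'I_n -> int) :
  outer_sum S v (fun j => f j + g j) = outer_sum S v f + outer_sum S v g.
Proof. by rewrite /outer_sum big_split. Qed.

Lemma wexp_ge0 (S : {set 'I_n}) (l : 'I_n -> int) v :
  wgt adj e S l != 0 -> v \in S -> 0 <= wexp adj e S l v.
Proof.
move=> w0 vS; rewrite leNgt; apply: contra w0 => lt0.
by rewrite /wgt (bigD1 v) //= cfz_lt0 // mul0r.
Qed.

Hypothesis ndT : neg_def adj e [set: 'I_n].
Hypothesis eN2 : forall v, e v <= -2.

(** * Summing out one leaf *)

Section RemoveLeaf.
Variables (S : {set 'I_n}) (u p : 'I_n) (tau : 'I_n -> int -> int).
Hypotheses (VS : V \subset S) (uS : u \notin S) (pS : p \in S) (up : adj u p).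
Hypothesis uniq_p : forall w, w \in S -> adj u w -> w = p.
Hypothesis inv : summed_out (u |: S) tau.
Variable Delta : 'I_n -> int.
Hypotheses (Delta0 : forall v, 0 <= Delta v) (Delta_u : Delta u = 1)
  (DeltaS : forall v, v \in S -> Delta v = 0)
  (Delta_nef : forall w, w \notin S -> dgz Delta w <= 0).

Let uV : u \notin V.
Proof. by apply: contra uS; apply: (fintype.subsetP VS). Qed.
Let uU : u \in u |: S. Proof. by rewrite !inE eqxx. Qed.
Let SU v : v \in S -> v \in u |: S. Proof. by rewrite !inE => ->; rewrite orbT. Qed.
Let offU w : w \notin u |: S -> w \notin S.
Proof. by apply: contra => /SU. Qed.
Let neu v : v \in S -> v != u. Proof. by move=> vS; apply: contraNneq uS => <-. Qed.

Let sum_u (f : 'I_n -> int) :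
  \sum_(w | adj u w) f w = f p + outer_sum (u |: S) u f.
Proof.
rewrite /outer_sum (bigD1 p) //=; congr (_ + _); apply: eq_bigl => w; rewrite !inE.
case uw: (adj u w) => //=; rewrite ?andbF //= andbT.
have wu : w != u by apply: contraTneq uw => ->; rewrite adj_irr.
rewrite (negbTE wu) /=; case: (eqVneq w p) => [->|wp]; first by rewrite pS.
by symmetry; apply: contra wp => wS; apply/eqP; apply: uniq_p.
Qed.

Let sum_v v (f : 'I_n -> int) : v \in S ->
  outer_sum S v f = (if v == p then f u else 0) + outer_sum (u |: S) v f.
Proof.
move=> vS; rewrite /outer_sum; case: eqVneq => [->|vp].
  rewrite (bigD1 u) /=; last by rewrite uS adj_sym.
  congr (_ + _); apply: eq_bigl => w; rewrite !inE negb_or.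
  by case: (w == u); rewrite /= ?andbF ?andbT.
rewrite add0r; apply: eq_bigl => w; rewrite !inE negb_or.
case: (eqVneq w u) => [->|] //=; apply/negbTE; rewrite uS /= adj_sym.
by apply: contra vp => uv; apply/eqP; apply: uniq_p.
Qed.

(** In u |: S the vertex u has valency 1, so its factor comes from (1 - x)^(-1): it is 1 if h (l_u)
    + l_p >= 1, and 0 otherwise. *)
Let h (b : int) : int := e u * b + tau u b.

Let h0 : h 0 = 0.
Proof. by rewrite /h (so_zero inv) // ?mulr0 //; left. Qed.
Let hN1 : 2 <= h (-1).
Proof. by rewrite /h (so_zero inv) //; [have := eN2 u; lia | left]. Qed.

Let h_shift (D : 'I_n -> int) (b : int) : (forall v, 0 <= D v) ->
  (forall w, w \notin u |: S -> dgz D w <= 0) ->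
  h b + D p - dgz D u <= h (b - D u).
Proof.
move=> D0 Dnef; have := so_mono inv D0 Dnef b uU.
by rewrite /h /dg intz sum_u; lia.
Qed.

Let h_noninc b : h b <= h (b - 1).
Proof.
have := @h_shift Delta b Delta0 (fun w wU => Delta_nef (offU wU)).
rewrite Delta_u DeltaS // => hs; apply: le_trans hs; have := Delta_nef uS; lia.
Qed.

Let h_unbounded : exists2 d, 0 <= d & forall b, h b + 1 <= h (b - d).
Proof.
have [Z [Z0 _ Znef]] := strict_nef adj_sym adj_irr ndT [set: 'I_n].
exists (Z u) => // b.
have := @h_shift Z b Z0 _; have := Znef u (in_setT u); have := Z0 p.
move=> Zp Zu hZ; apply: le_trans (hZ _); first by lia.
by move=> w _; have := Znef w (in_setT w); lia.
Qed.

(** [Delta] has coefficient 1 at u, which makes [h] nonincreasing in unit steps; a strictly anti-nef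
    cycle makes it unbounded in both directions. So the condition at u cuts out a ray. *)
Let exists_beta (a : int) : exists beta : int, forall b : int, (1 <= h b + a) = (b <= beta).
Proof.
have [d d0 hd] := h_unbounded.
have up_h (k : nat) : k%:Z <= h (- (k%:Z * d)).
  elim: k => [|k IH]; first by rewrite mul0r oppr0 h0.
  have -> : - (k.+1%:Z * d) = - (k%:Z * d) - d by rewrite -addn1 PoszD; ring.
  by apply: le_trans (hd _); lia.
have down_h (k : nat) : h (k%:Z * d) <= - k%:Z.
  elim: k => [|k IH]; first by rewrite mul0r oppr0 h0.
  have kE : k%:Z * d = k.+1%:Z * d - d by rewrite -addn1 PoszD; ring.
  by have := hd (k.+1%:Z * d); rewrite -kE; lia.
apply: (@int_threshold _ (- ((`|a|.+1)%N%:Z * d)) (`|a|%N%:Z * d)).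
- by move=> b; have := h_noninc b; lia.
- by have := up_h `|a|.+1; lia.
- by have := down_h `|a|%N; lia.
Qed.

(** Summing the factor at p over l_u <= gam turns (1 - x)^(m+1) into (1 - x)^m and moves the
    exponent by gam + 1, which is the new contribution to the shift at p. *)
Lemma summed_out_leaf : exists tau', summed_out S tau'.
Proof.
have [beta betaP] := choice exists_beta.
(* Truncation at -1 reflects l_u < 0. It is left out for p off [V], where [so_max] has no sign
   condition; by [gamE] both forms agree when l_p < 0. *)
pose gam (a : int) : int := if p \in V then Num.min (beta a) (-1) else beta a.
pose tau' v (a : int) : int := if v == p then tau p a + (gam a + 1) else tau v a.
have beta_le0 a : a <= 0 -> beta a <= -1.
  by move=> a0; have := betaP a 0; rewrite h0; lia.
have beta_geN1 a : -1 <= a -> -1 <= beta a.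
  by move=> a1; rewrite -betaP (@le_trans _ _ (2 + a)) ?lerD2r ?hN1 //; lia.
have gamE a : (p \notin V -> a < 0) -> gam a = Num.min (beta a) (-1).
  rewrite /gam; case: (p \in V) => // /(_ isT) a0.
  by have := beta_le0 a (ltW a0); lia.
exists tau'; split.
- move=> v vS vin a; rewrite /tau'; case: eqP => [vp|_].
    by have := vin u; rewrite vp adj_sym up (negbTE uS) => /(_ isT).
  by apply: (so_inner inv) => [|w vw]; apply: SU => //; apply: vin.
- move=> v a vS a1 av; rewrite /tau'; case: eqP => [vp|_]; last first.
    by apply: (so_zero inv) => //; apply: SU.
  rewrite (so_zero inv) ?SU -?vp //.
  have := beta_geN1 a a1; rewrite /gam -vp.
  case: ifP av => [_ _|_ [a0|//]]; first by lia.
  by have := beta_le0 a a0; lia.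
- move=> D D0 Dnef v b vS; rewrite sum_v //.
  have DnefU w : w \notin u |: S -> dgz D w <= 0 by move=> /offU; apply: Dnef.
  have := so_mono inv D0 DnefU b (SU vS); rewrite /tau'; case: eqP => [->|_]; last by lia.
  suff : gam b - D u <= gam (b - D p) by lia.
  (* The pair l_p = b, l_u = beta b satisfies the condition at u, and by [h_shift] with (D, E_u) <=
     0 it still does after subtracting D. *)
  have : beta b - D u <= beta (b - D p).
    rewrite -betaP; have := h_shift (beta b) D0 DnefU; have := Dnef u uS.
    by have := betaP b (beta b); rewrite lexx; lia.
  by rewrite /gam; have := D0 u; case: ifP => _; lia.
- move=> l lnef v vS vV; rewrite sum_v // /tau'.
  have lnefU w : w \notin u |: S -> 2 - val [set: 'I_n] w <= dgz l w.
    by move=> /offU; apply: lnef.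
  have := so_max inv lnefU (SU vS) vV; case: eqP => [vp|_]; last by lia.
  rewrite vp; suff : l u <= gam (l p) by lia.
  (* The lower bound on (l, E_u), with the outer neighbours of u replaced by the shift through
     [so_max] at u, is exactly the condition defining the ray. *)
  have le_beta : l u <= beta (l p).
    rewrite -betaP /h.
    pose o1 := outer_sum (u |: S) u (fun=> 1); pose ol := outer_sum (u |: S) u l.
    have H1 : ol + o1 <= tau u (l u).
      by rewrite /ol /o1 -outer_sumD; apply: (so_max inv lnefU uU (or_introl uV)).
    have H2 : 2 - (1 + o1) <= e u * l u + (l p + ol).
      by have := lnef u uS; rewrite valencyT /dg intz !sum_u.
    by lia.
  rewrite /gam; case: ifP => // pV; move: vV; rewrite vp pV => -[//|lp0].
  by have := beta_le0 _ lp0; lia.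
- move=> l0 l0neg.
  pose a := l0 p; pose m := val S p - 2; pose s := dg_in S l0 p + tau p a.
  pose rest := \prod_(v in S | v != p)
    cfz (val S v - 2) (val S v - 2 + dg_in S l0 v + tau v (l0 v)).
  pose lb (b : int) : vect := [ffun v => if v == u then b else l0 v].
  have lbS v b : v \in S -> lb b v = l0 v by move=> vS; rewrite ffunE (negbTE (neu vS)).
  have lbu b : lb b u = b by rewrite ffunE eqxx.
  have gamE' : gam a = Num.min (beta a) (-1) by apply: gamE; apply: l0neg.
  have adjvu v : v \in S -> adj v u = (v == p).
    move=> vS; apply/idP/eqP => [vu|->]; last by rewrite adj_sym.
    by apply: uniq_p => //; rewrite adj_sym.
  have val_u : valency adj S u = 1%N.
    rewrite /valency -(cards1 p); congr #|pred_of_set _|; apply/setP => w.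
    rewrite !inE; apply/andP/eqP => [[wS uw]|->]; last by rewrite pS up.
    exact: uniq_p.
  have dgb v b : v \in S ->
      dg_in (u |: S) (lb b) v = dg_in S l0 v + (if v == p then b else 0).
    move=> vS; rewrite /dg_in lbS // -addrA; congr (_ + _).
    rewrite big_mkcondr big_setU1 //= lbu adjvu // addrC; congr (_ + _).
    by rewrite [RHS]big_mkcondr; apply: eq_bigr => w wS; rewrite lbS.
  have dgu b : dg_in (u |: S) (lb b) u = e u * b + a.
    rewrite /dg_in lbu; congr (_ + _).
    rewrite big_mkcondr big_setU1 //= adj_irr add0r (bigD1 p) //= up lbS //.
    rewrite big1 ?addr0 // => w /andP[wS wp]; case: ifP => // uw.
    by case/eqP: wp; apply: uniq_p.
  have Wb b : b <= -1 -> shifted_wgt (u |: S) tau (lb b) =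
      (if b <= gam a then cfz (m + 1) (m + 1 + s + b) else 0) * rest.
    move=> b1; rewrite /shifted_wgt big_setU1 //= (bigD1 p) //= mulrA.
    congr (_ * _); last first.
      apply: eq_bigr => v /andP[vS vp]; rewrite valency_setU1 // adjvu //.
      by rewrite (negbTE vp) addn0 dgb // (negbTE vp) addr0 lbS.
    rewrite !valency_setU1 // adj_irr val_u dgu lbu adjvu // eqxx dgb // eqxx lbS //.
    have -> : (1 + false)%N%:Z - 2 = -1 by [].
    rewrite cfzN1.
    have -> : (0 <= -1 + (e u * b + a) + tau u b) = (b <= gam a).
      have -> : (b <= gam a) = (b <= beta a) by rewrite gamE'; lia.
      by rewrite -betaP /h; lia.
    case: ifP => _; rewrite ?mul0r // mul1r /m /s /a; congr cfz; lia.
  (* The first summand bounds -l_u when the exponent at p is nonnegative; the second meets the bound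
     in [sum_cfz_tail]. *)
  pose N := (`|(val [set: 'I_n] p - 2 + dg_in S l0 p)%R| + `|(m + s)%R|).+1%N.
  have -> : shifted_wgt S tau' l0 = \sum_(j < N) shifted_wgt (u |: S) tau (lb (-1 - j%:Z)).
    rewrite [RHS](eq_bigr (fun j : 'I_N => (if -1 - j%:Z <= gam a
      then cfz (m + 1) (m + 1 + s + (-1 - j%:Z)) else 0) * rest)); last first.
      by move=> j _; rewrite Wb //; lia.
    rewrite -mulr_suml /shifted_wgt (bigD1 p) //=; congr (_ * _); last first.
      by apply: eq_bigr => v /andP[vS /negbTE vp]; rewrite /tau' vp.
    pose j0 := `|(- 1 - gam a)%R|%N.
    have gj : gam a = - 1 - j0%:Z by rewrite /j0 gamE'; lia.
    rewrite -(@sum_cfz_tail m _ j0 N).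
      apply: eq_bigr => j _; rewrite gj.
      have -> : (-1 - j%:Z <= -1 - j0%:Z) = (j0 <= j)%N by lia.
      by case: ifP => // _; congr cfz; rewrite /tau' eqxx gj /s /a; lia.
    by rewrite /tau' eqxx -/a gj /N /m /s; lia.
  apply: (@has_sum_fibers (extends S l0) (fun l : vect => l u) N
    (fun j => shifted_wgt (u |: S) tau (lb (-1 - j%:Z)))) => [j jN|l lext w0].
    apply: has_sum_equiv (so_sum inv (l0 := lb (-1 - j%:Z)) _) => [l _|v].
      split=> [[lU lneg]|[[lS lneg] lu]].
        split; last by rewrite lU // lbu.
        split=> v vS; first by rewrite lU ?SU // lbS.
        case: (eqVneq v u) => [->|vu]; first by rewrite lU // lbu; lia.
        by apply: lneg; rewrite !inE negb_or vu.
      split=> v; last by move=> /offU; apply: lneg.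
      by rewrite !inE => /orP[/eqP ->|vS]; rewrite ?lu ?lbu // lbS // lS.
    by rewrite !inE => /orP[/eqP ->|vS]; rewrite ?lbu ?lbS //; [lia | apply: l0neg].
  case: lext => lS lneg.
  exists `|(-1 - l u)%R|%N; last by have := lneg u uS; lia.
  have := wexp_ge0 w0 (in_setT p); rewrite /wexp (dg_split S) sum_v // eqxx.
  have -> : dg_in S l p = dg_in S l0 p.
    by rewrite /dg_in lS //; congr (_ + _); apply: eq_bigr => w /andP[wS _]; apply: lS.
  have : outer_sum (u |: S) p l <= 0.
    by apply: sumr_le0 => w /andP[/offU /lneg /ltW].
  by have := lneg u uS; rewrite /N; lia.
Qed.

End RemoveLeaf.

Hypothesis connT : connected adj [set: 'I_n].
Hypothesis chi2_nonneg : forall f : 'I_n -> int, (forall v, 0 <= f v) ->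
  (exists v, f v != 0) -> 0 <= chi2 adj e f.
Variable g : 'I_n -> int.
Hypotheses (g0 : forall v, 0 <= g v) (gn : exists v, g v != 0)
  (gV : forall v, v \notin V -> g v = 0) (cg : chi2 adj e g <= 0).

(** Induction on the number of vertices outside [S]: adjoin a leaf u, treat u |: S by induction,
    then sum u out with the cycle from [nef_on_branch]. *)
Lemma exists_summed_out : V != finset.set0 -> (deg_sum adj V + 2 = 2 * #|V|)%N ->
  (deg_sum adj [set: 'I_n] + 2 = 2 * n)%N -> exists tau, summed_out V tau.
Proof.
move=> V0 eV eT.
suff main k (S : {set 'I_n}) : (#|~: S| < k)%N -> V \subset S ->
    (deg_sum adj S + 2 = 2 * #|S|)%N -> exists tau, summed_out S tau.
  exact: (main _ V (ltnSn _)).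
elim: k S => // k IH S; rewrite ltnS => Sk VS eS.
have [->|ST] := eqVneq S [set: 'I_n]; first by exists (fun _ _ => 0); apply: summed_outT.
have S0 : S != finset.set0.
  by case/set0Pn: V0 => x xV; apply/set0Pn; exists x; apply: (fintype.subsetP VS).
have [u [p [uS pS up uniq_p eU]]] := exists_leaf adj_sym adj_irr connT S0 ST eS eT.
have [||tau inv] := IH (u |: S) _ _ eU.
- apply: leq_trans Sk; apply: proper_card; apply/properP; split.
    by rewrite setCS finset.subsetUr.
  by exists u; rewrite ?inE // eqxx.
- by apply: (subset_trans VS); rewrite finset.subsetUr.
have [D [D0 Du DS Dnef]] := nef_on_branch adj_sym adj_irr ndT connT chi2_nonneg
  g0 gn gV cg VS uS pS up.
exact: (summed_out_leaf VS uS pS up uniq_p inv D0 Du DS Dnef).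
Qed.

End Summation.

(** * The NN-elliptic sequence *)

Section NNSequence.
Variable n : nat.
Variable adj : rel 'I_n.
Variable e : 'I_n -> int.
Hypothesis adj_sym : symmetric adj.
Hypothesis adj_irr : irreflexive adj.
Hypothesis ndT : neg_def adj e [set: 'I_n].
Hypothesis connT : connected adj [set: 'I_n].
Hypothesis eN2 : forall v, e v <= -2.
Hypothesis chi2_ge0 : forall f : 'I_n -> int, (forall v, 0 <= f v) ->
  (exists v, f v != 0) -> 0 <= chi2 adj e f.

Local Notation T := [set: 'I_n].
Local Notation vect := 'rV[rat]_n.
Local Notation dgq := (@dg n adj e rat).
Local Notation K := (ZK adj e T).

Definition vmin (x y : vect) : vect := \row_v Num.min (co x v) (co y v).

Lemma co_vmin x y v : co (vmin x y) v = Num.min (co x v) (co y v).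
Proof. by rewrite /co mxE. Qed.

Lemma dg_vmin (x y : vect) v : dgq (co x) v <= 0 -> dgq (co y) v <= 0 ->
  dgq (co (vmin x y)) v <= 0.
Proof.
move=> xv yv; case: (leP (co x v) (co y v)) => h.
  apply: le_trans xv; apply: dg_le_off => [|w _]; rewrite co_vmin; first exact: min_l.
  by rewrite ge_min lexx.
apply: le_trans yv; apply: dg_le_off => [|w _]; rewrite co_vmin.
  by rewrite min_r // ltW.
by rewrite ge_min lexx orbT.
Qed.

Lemma dg_int (x : 'I_n -> rat) v : (forall w, x w \is a Num.int) -> dgq x v \is a Num.int.
Proof.
by move=> xi; rewrite /dg rpredD ?rpredM ?intr_int // rpred_sum.
Qed.

(** Descent on the sum of the coefficients: if y is not above x, replacing x by min (x, y) lowers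
    the sum by at least 1, because the differences are integral. *)
Lemma minimum_spec (S : {set 'I_n}) (A : vect -> Prop) :
  (exists x, A x) -> (forall x v, A x -> 0 <= co x v) ->
  (forall x y v, A x -> A y -> co x v - co y v \is a Num.int) ->
  (forall x y, A x -> A y -> A (vmin x y)) ->
  A (minimum S A) /\ forall y, A y -> leS S (minimum S A) y.
Proof.
move=> [x0 Ax0] A0 Aint Amin.
apply: (@xgetPex _ (0 : vect) (fun x => A x /\ forall y, A y -> leS S x y)).
have [k xk] : exists k : nat, \sum_v co x0 v < k%:R.
  by exists (Num.bound (\sum_v co x0 v)); apply: archi_boundP; apply: sumr_ge0 => v _; apply: A0.
elim: k x0 Ax0 xk => [|k IH] x Ax xk.
  suff : 0 <= \sum_v co x v by move=> h; have := le_lt_trans h xk; rewrite ltxx.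
  by apply: sumr_ge0 => v _; apply: A0.
case: (pselect (forall y, A y -> leS S x y)) => [xmin|]; first by exists x.
move=> /existsNP[y] /not_implyP[Ay] /existsNP[v] /not_implyP[vS] /negP.
rewrite -ltNge => yx; apply: (IH (vmin x y)); first exact: Amin.
have le_vmin w : co (vmin x y) w <= co x w by rewrite co_vmin ge_min lexx.
have : co (vmin x y) v + 1 <= co x v.
  rewrite co_vmin min_r ?(ltW yx) //; have /intrP[z zE] := Aint x y v Ax Ay.
  have : 0 < z by rewrite -(ltr0z rat) -zE subr_gt0.
  by rewrite gtz0_ge1 -(ler1z rat) -zE; lra.
have : \sum_(w | w != v) co (vmin x y) w <= \sum_(w | w != v) co x w by apply: ler_sum.
move: xk; rewrite (bigD1 v) //= [X in _ -> _ -> X < _](bigD1 v) //= -addn1 natrD.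
by lra.
Qed.

Lemma ZK_T v : dgq (co K) v = (e v + 2)%:~R.
Proof. by have [_ ->] := ZK_spec adj_sym adj_irr ndT T. Qed.

Lemma e2_le0 v : ((e v + 2)%:~R : rat) <= 0.
Proof. by rewrite lerz0; have := eN2 v; lia. Qed.

Lemma s_ZK_cond (x : vect) :
  (Sprime adj e T x /\ in_lattice T (x - K)) <->
  (forall v, dgq (co x) v <= 0) /\ (forall v, co x v - co K v \is a Num.int).
Proof.
split=> [[[_ nef] [_ lat]]|[nef lat]].
  split=> v; first by rewrite -(form_Evec e adj_sym adj_irr (inST x) (in_setT v)) nef ?inE.
  by rewrite -coB lat.
split; last by split=> [|v _]; [apply: inST | rewrite coB].
split; last by move=> v _; rewrite form_Evec ?inE //; apply: inST.
split=> [|w _]; first exact: inST.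
rewrite form_Evec ?inE //; last exact: inST.
have -> : dgq (co x) w = dgq (co K) w + dgq (fun v => co x v - co K v) w by rewrite dgB; ring.
by rewrite ZK_T rpredD ?intr_int // dg_int.
Qed.

Lemma s_ZK_spec (s := s_ZK adj e T) :
  [/\ forall v, dgq (co s) v <= 0, forall v, co s v - co K v \is a Num.int &
    forall x : vect, (forall v, dgq (co x) v <= 0) ->
      (forall v, co x v - co K v \is a Num.int) -> forall v, co s v <= co x v].
Proof.
have [||||sA smin] := @minimum_spec T (fun x => Sprime adj e T x /\ in_lattice T (x - K)).
- exists K; apply/s_ZK_cond; split=> v; first by rewrite ZK_T e2_le0.
  by rewrite subrr rpred0.
- move=> x v /s_ZK_cond[nef _].
  by apply: (nef_ge0 adj_sym adj_irr ndT (S := T)) => // w; rewrite inE.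
- move=> x y v /s_ZK_cond[_ xi] /s_ZK_cond[_ yi].
  have -> : co x v - co y v = (co x v - co K v) - (co y v - co K v) by ring.
  by rewrite rpredB.
- move=> x y /s_ZK_cond[xn xi] /s_ZK_cond[yn yi]; apply/s_ZK_cond; split=> v.
    exact: dg_vmin.
  by rewrite co_vmin; case: (leP (co x v) (co y v)).
move/s_ZK_cond: sA => [s1 s2]; split=> // x xn xi v.
by apply: smin; [apply/s_ZK_cond | rewrite inE].
Qed.

Lemma Zmin_cond (B : {set 'I_n}) (x : vect) :
  (Sprime adj e B x /\ in_lattice B x /\ x != 0) <->
  [/\ inS B x, forall v, v \in B -> dgq (co x) v <= 0,
      forall v, co x v \is a Num.int & x != 0].
Proof.
split=> [[[[xB _] nef] [[_ lat] x0]]|[xB nef lat x0]].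
  split=> // v; first by move=> vB; rewrite -(form_Evec e adj_sym adj_irr xB) // nef.
  by case: (boolP (v \in B)) => [/lat//|/xB->]; rewrite rpred0.
split; last by split=> //; split.
by split; [split=> // w wB|move=> v vB]; rewrite form_Evec ?nef // dg_int.
Qed.

Lemma floor_lat (x : 'I_n -> rat) v : x v \is a Num.int -> (Num.floor (x v))%:~R = x v.
Proof. by case/intrP => z ->; rewrite intrKfloor. Qed.

Section Gorenstein.
(* [Y] is the anticanonical cycle of its support [B]. *)
Variable Y : vect.
Hypotheses (Y0 : forall v, 0 <= co Y v) (Yint : forall v, co Y v \is a Num.int)
  (YK : forall v, co Y v != 0 -> dgq (co Y) v = (e v + 2)%:~R) (Yn : Y != 0).
Local Notation B := (supp T Y).

Lemma in_supp v : (v \in B) = (co Y v != 0).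
Proof. by rewrite !inE. Qed.

(** An edge inside [B] from supp x to a zero u of x would give (x, E_u) > 0. So the zeros of x would
    split Y into two nonzero disjoint pieces with chi = 0, against [no_disjoint_chi2_le0]. *)
Lemma nef_full_support (x : vect) : inS B x -> x != 0 ->
  (forall v, v \in B -> dgq (co x) v <= 0) -> forall v, v \in B -> 0 < co x v.
Proof.
move=> xB xn nef.
have x0 v : 0 <= co x v by apply: (nef_ge0 adj_sym adj_irr ndT xB nef).
move=> w wB; rewrite lt_def x0 andbT; apply/negP => /eqP xw.
pose cut (P : pred 'I_n) v : int := if P v then Num.floor (co Y v) else 0.
pose P v := co x v != 0; pose P' v := co x v == 0.
have cut0 Q v : 0 <= cut Q v.
  by rewrite /cut; case: ifP => // _; rewrite floor_ge0.
have Qchi (Q : pred 'I_n) : (forall v w, Q v -> ~~ Q w -> adj v w -> co Y v != 0 -> co Y w = 0) ->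
    chi2 adj e (cut Q) <= 0.
  move=> hQ; rewrite /chi2 big1 // => v _; rewrite {1}/cut.
  case: ifP => Qv; last by rewrite mul0r.
  have [Yv|Yv] := eqVneq (co Y v) 0.
    by rewrite Yv (_ : Num.floor 0 = 0) ?mul0r // floor0.
  rewrite (_ : e v + 2 - dg adj e (cut Q) v = 0) ?mulr0 //.
  apply/eqP; rewrite subr_eq0 eq_sym -(eqr_int rat) -dg_intr -YK //; apply/eqP.
  rewrite /dg /cut Qv floor_lat //; congr (_ + _); apply: eq_bigr => u vu.
  case: ifP => Qu; first by rewrite floor_lat.
  by rewrite (hQ v u) ?Qu.
have sep v u : adj v u -> P v -> P' u -> co Y u != 0 -> False.
  move=> vu Pv /eqP xu; rewrite -in_supp => /nef.
  rewrite /dg xu mulr0 add0r leNgt => /negP; apply.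
  rewrite (bigD1 v) /=; last by rewrite adj_sym.
  by rewrite ltr_wpDr ?sumr_ge0 // lt_def x0 andbT.
apply: (no_disjoint_chi2_le0 adj_sym adj_irr connT chi2_ge0
  (f := cut P) (g := cut P')) => //.
- have /existsP[v xv] : [exists v, co x v != 0].
    apply: contraNT xn; rewrite negb_exists => /forallP h; apply/eqP/co_inj => v.
    by rewrite co0; apply/eqP; rewrite -[_ == _]negbK.
  have Yv : co Y v != 0 by rewrite -in_supp; apply: contraNT xv => /xB ->.
  exists v; rewrite /cut /P xv; apply: contra Yv => /eqP h.
  by rewrite -(floor_lat (Yint v)) h.
- exists w; rewrite /cut /P' xw eqxx; move: wB; rewrite in_supp; apply: contra => /eqP h.
  by rewrite -(floor_lat (Yint w)) h.
- by move=> v; rewrite /cut /P /P'; case: eqP => _; rewrite ?mul0r ?mulr0.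
- apply: Qchi => v u Pv; rewrite negbK => Pu vu Yv; apply/eqP.
  by apply/negPn/negP; apply: sep vu Pv Pu.
- apply: Qchi => v u Pv Pu vu Yv; exfalso.
  by apply: (sep u v) => //; rewrite adj_sym.
Qed.

(** Y itself is a candidate, and [nef_full_support] keeps the minimum of two candidates nonzero. *)
Lemma Zmin_spec (Z := Zmin adj e B) :
  [/\ inS B Z, forall v, v \in B -> dgq (co Z) v <= 0, forall v, co Z v \is a Num.int &
    forall x : vect, inS B x -> (forall v, v \in B -> dgq (co x) v <= 0) ->
      (forall v, co x v \is a Num.int) -> x != 0 -> forall v, co Z v <= co x v].
Proof.
have Bn : exists v, v \in B.
  apply/existsP; apply: contraNT Yn; rewrite negb_exists => /forallP h.
  by apply/eqP/co_inj => v; have := h v; rewrite in_supp negbK co0 => /eqP.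
have [||||ZA Zmin'] := @minimum_spec B
   (fun x => Sprime adj e B x /\ in_lattice B x /\ x != 0).
- exists Y; apply/Zmin_cond; split=> // v; first by rewrite in_supp negbK => /eqP.
  by rewrite in_supp => /YK ->; apply: e2_le0.
- by move=> x v /Zmin_cond[xB nef _ _]; apply: (nef_ge0 adj_sym adj_irr ndT xB nef).
- by move=> x y v /Zmin_cond[_ _ xi _] /Zmin_cond[_ _ yi _]; rewrite rpredB.
- move=> x y /Zmin_cond[xB xn xi x0] /Zmin_cond[yB yn yi y0]; apply/Zmin_cond; split.
  + by move=> v vB; rewrite co_vmin xB // yB // minxx.
  + by move=> v vB; apply: dg_vmin; [apply: xn | apply: yn].
  + by move=> v; rewrite co_vmin; case: (leP (co x v) (co y v)).
  + case: Bn => v vB; have := nef_full_support xB x0 xn vB.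
    have := nef_full_support yB y0 yn vB => hy hx.
    have : 0 < co (vmin x y) v by rewrite co_vmin lt_min hx hy.
    by apply: contraTneq => ->; rewrite co0 ltxx.
move/Zmin_cond: ZA => [ZB Zn Zi _]; split=> // x xB xn xi x0 v.
case: (boolP (v \in B)) => vB; last by rewrite ZB // xB.
by apply: Zmin' => //; apply/Zmin_cond.
Qed.

End Gorenstein.

(* chi (y) = (y, z) / 2 <= 0 forces (z, E_v) = 0 on the support of y. *)
Lemma nef_part_orthogonal (y z : 'I_n -> rat) :
  (forall v, 0 <= y v) -> (forall v, y v \is a Num.int) -> (exists v, y v != 0) ->
  (forall v, y v != 0 -> dgq y v = (e v + 2)%:~R - dgq z v) ->
  (forall v, y v != 0 -> dgq z v <= 0) ->
  forall v, y v != 0 -> dgq y v = (e v + 2)%:~R.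
Proof.
move=> y0 yi yn yz nef.
pose f v := Num.floor (y v).
have fE v : (f v)%:~R = y v by apply: floor_lat.
have : 0 <= chi2 adj e f.
  apply: chi2_ge0 => [v|]; first by rewrite floor_ge0.
  case: yn => v yv; exists v; apply: contra yv => /eqP fv.
  by rewrite -fE fv.
have chiE : (chi2 adj e f)%:~R = \sum_v y v * dgq z v.
  rewrite /chi2 rmorph_sum; apply: eq_bigr => v _ /=; rewrite intrM fE.
  have [->|yv] := eqVneq (y v) 0; first by rewrite !mul0r.
  congr (_ * _); rewrite intrB -dg_intr (eq_dg _ _ fE) yz //; ring.
have term0 v : y v * dgq z v <= 0.
  have [->|yv] := eqVneq (y v) 0; first by rewrite mul0r.
  by apply: mulr_ge0_le0 => //; apply: nef.
rewrite -(ler_int rat) chiE => sum0.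
have : \sum_v - (y v * dgq z v) == 0.
  rewrite eq_le; apply/andP; split; first by rewrite sumrN oppr_le0.
  by apply: sumr_ge0 => v _; rewrite oppr_ge0.
rewrite psumr_eq0 => [|v _]; last by rewrite oppr_ge0.
move=> /allP all0 v yv; have := all0 v (mem_index_enum v).
by rewrite /= oppr_eq0 mulf_eq0 (negbTE yv) /= => /eqP zv; rewrite yz // zv subr0.
Qed.

Local Notation Y j := (K - Acc adj e T j).

Lemma vec_neq0 (x : vect) : x != 0 -> exists v, co x v != 0.
Proof.
move=> xn; apply/existsP; apply: contraNT xn; rewrite negb_exists => /forallP h.
by apply/eqP/co_inj => v; have := h v; rewrite negbK co0 => /eqP.
Qed.

(** There is no candidate, so the default 0 is returned: once the remainder vanishes, [Acc] stays
    constant. *)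
Lemma Zmin_set0 : Zmin adj e finset.set0 = 0 :> vect.
Proof.
rewrite /Zmin /minimum; case: xgetP => // y _ [[_ [[y0 _] yn]] _].
by apply: co_inj => v; rewrite co0 y0 // inE.
Qed.

(** A new remainder is the old one minus an anti-nef cycle (Z_K minus s at the start), nonnegative
    by minimality of that cycle; [nef_part_orthogonal] then restores adjunction on its support. *)
Lemma remainder_spec j : Y j != 0 ->
  [/\ forall v, 0 <= co (Y j) v, forall v, co (Y j) v \is a Num.int &
      forall v, co (Y j) v != 0 -> dgq (co (Y j)) v = (e v + 2)%:~R].
Proof.
elim: j => [|j IH] /= Yn.
  have [sn si smin] := s_ZK_spec.
  have y0 v : 0 <= co (K - s_ZK adj e T) v.
    rewrite coB subr_ge0; apply: smin => w; first by rewrite ZK_T e2_le0.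
    by rewrite subrr rpred0.
  have yi v : co (K - s_ZK adj e T) v \is a Num.int.
    by rewrite coB -opprB rpredN.
  split=> //.
  apply: (nef_part_orthogonal (z := co (s_ZK adj e T)) y0 yi (vec_neq0 Yn)) => // v _.
  by rewrite (eq_dg _ _ (coB _ _)) dgB ZK_T.
have YN : Y j != 0.
  apply: contraNneq Yn => Yj; rewrite Yj.
  have -> : supp T (0 : vect) = finset.set0 by apply/setP => v; rewrite !inE co0 eqxx.
  by rewrite Zmin_set0 addr0 Yj.
have [y0 yi yK] := IH YN; have [ZB Zn Zi Zmin'] := Zmin_spec y0 yi yK YN.
set Z := Zmin _ _ _ in Yn ZB Zn Zi Zmin' *.
have YE : K - (Acc adj e T j + Z) = Y j - Z by rewrite opprD addrA.
rewrite YE in Yn *.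
have y'0 v : 0 <= co (Y j - Z) v.
  rewrite coB subr_ge0; apply: Zmin' => // w; rewrite in_supp; first by rewrite negbK => /eqP.
  by move=> /yK ->; apply: e2_le0.
have y'i v : co (Y j - Z) v \is a Num.int by rewrite coB rpredB.
have sub v : co (Y j - Z) v != 0 -> v \in supp T (Y j).
  by apply: contraNT => vB; rewrite coB ZB // subr0; move: vB; rewrite in_supp negbK.
split=> //.
apply: (nef_part_orthogonal (z := co Z) y'0 y'i (vec_neq0 Yn)) => v /sub vB.
  by rewrite (eq_dg _ _ (coB _ _)) dgB yK // -in_supp.
exact: Zn.
Qed.

(* With y = max (E + l, 0) on V, the remainder q = Y_{i-1} - y is anti-nef (for
   i = 0: q = Z_K - y), hence q >= Z_{B_{i-1}} (resp. q >= s), i.e. y <= Y_i. *)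
Lemma exponent_neg (V : {set 'I_n}) i (l : 'I_n -> int) : is_index adj e T V i ->
  (forall v, v \notin V -> l v = 0) -> (forall v, v \in V -> 0 <= wexp adj e V l v) ->
  forall v, v \in V -> v \notin NNB adj e T i -> l v < 0.
Proof.
move=> [_ [_ Vprop]] lV wl.
pose y v : rat := (Num.max ((v \in V)%:Z + l v) 0)%:~R.
have y0 v : 0 <= y v by rewrite ler0z le_max lexx orbT.
have yi v : y v \is a Num.int by apply: intr_int.
have yV v : v \notin V -> y v = 0.
  by move=> vV; rewrite /y (negbTE vV) lV // addr0 maxxx.
(* Where y_v > 0 this is [wexp] >= 0; where y_v = 0 it is (y, E_v) >= 0 >= e_v + 2. *)
have dgy v : (e v + 2)%:~R <= dgq y v.
  have [yv|yv] := eqVneq (y v) 0.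
    by apply: le_trans (e2_le0 v) _; apply: dg_ge0_off.
  have vV : v \in V by apply: contraNT yv => /yV ->.
  pose x w : rat := (w \in V)%:R + (l w)%:~R.
  have xE w : x w = ((w \in V)%:Z + l w)%:~R by rewrite /x intrD -pmulrn.
  have -> : (e v + 2)%:~R = dgq x v - (wexp adj e V l v)%:~R.
    rewrite dgD dg_ones // dg_intr /wexp !rmorphD rmorphN /=; ring.
  apply: (@le_trans _ _ (dgq x v)); first by rewrite gerBl ler0z wl.
  apply: dg_le_off => [|w _]; rewrite xE /y; last by rewrite ler_int le_max lexx.
  congr (_%:~R); rewrite max_l // leNgt; apply: contra yv => h.
  by rewrite /y max_r // ltW.
suff le_y v : v \in V -> v \notin NNB adj e T i -> y v <= 0.
  move=> v vV vB; have := le_y v vV vB; rewrite lerz0 ge_max vV => /andP[h _].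
  by lia.
pose yr : vect := \row_v y v.
have yrE : co yr =1 y by move=> w; rewrite /co mxE.
have YB j w : w \notin NNB adj e T j -> co (Y j) w = 0.
  by rewrite in_supp negbK => /eqP.
move=> vV vB; have := YB _ _ vB.
case: i Vprop vB => [|j] /= Vprop vB; rewrite ?coB.
  have [_ _ smin] := s_ZK_spec.
  have : co (s_ZK adj e T) v <= co K v - y v.
    rewrite -yrE -coB; apply: smin => w; rewrite ?(eq_dg _ _ (coB _ _)) ?dgB.
      by rewrite ZK_T (eq_dg _ _ yrE) subr_le0.
    by rewrite coB yrE addrAC subrr add0r rpredN.
  by lra.
(* A vertex x of B_{i-1} outside [V], where y vanishes, makes the remainder q nonzero, as minimality
   of Z_{B_{i-1}} requires. *)
have /andP[VB /fintype.subsetPn[x xB xV]] := Vprop.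
have Yn : Y j != 0.
  by move: xB; rewrite in_supp; apply: contraNneq => ->; rewrite co0.
have [Y0 Yi YK] := remainder_spec Yn.
have [ZB Zn Zi Zmin'] := Zmin_spec Y0 Yi YK Yn.
have coq w : co (Y j - yr) w = co (Y j) w - y w by rewrite coB yrE.
have : co (Zmin adj e (supp T (Y j))) v <= co (Y j) v - y v.
  rewrite -coq; apply: Zmin' => [w wB|w wB|w|].
  - rewrite coq YB // yV ?subr0 //.
    by apply: contra wB; apply: (fintype.subsetP VB).
  - by rewrite (eq_dg _ _ coq) dgB YK -?in_supp // subr_le0.
  - by rewrite coq rpredB.
  - apply/eqP => q0; have := coq x; rewrite q0 co0 yV // subr0 => /esym /eqP.
    by apply/negP; rewrite -in_supp.
rewrite coB coD; lra.
Qed.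

End NNSequence.

(** * Restricting exponents to a subgraph attached at end-vertices *)

Section Extensions.
Variable n : nat.
Variable adj : rel 'I_n.
Variable e : 'I_n -> int.
Hypothesis adj_sym : symmetric adj.
Hypothesis adj_irr : irreflexive adj.
Hypothesis ndT : neg_def adj e [set: 'I_n].

Local Notation T := [set: 'I_n].
Local Notation dgz := (@dg n adj e int).

Lemma chi_chi2 (S : {set 'I_n}) (x : 'rV[rat]_n) (f : 'I_n -> int) :
  inS S x -> (forall v, co x v = (f v)%:~R) -> chi adj e S x = (chi2 adj e f)%:~R / 2.
Proof.
move=> xS xf; have [KS KE] := ZK_spec adj_sym adj_irr ndT S.
rewrite /chi form_bil // => [|v vS]; last by rewrite coB xS // KS // subr0.
congr (_ / _); rewrite /bil -sumrN /chi2 rmorph_sum; apply: eq_bigr => v _ /=.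
rewrite intrM xf -mulrN; case: (boolP (v \in S)) => vS; last first.
  by rewrite -xf xS // !mul0r.
by rewrite (eq_dg _ _ (coB _ _)) dgB KE // (eq_dg _ _ xf) dg_intr opprB -intrB.
Qed.

Lemma elliptic_chi2_ge0 : elliptic adj e T ->
  forall f : 'I_n -> int, (forall v, 0 <= f v) -> (exists v, f v != 0) -> 0 <= chi2 adj e f.
Proof.
move=> [_ [_ [_ [chi0 _]]]] f f0 [v fv].
pose x : 'rV[rat]_n := \row_v (f v)%:~R.
have xf w : co x w = (f w)%:~R by rewrite /co mxE.
have := chi0 x; rewrite (chi_chi2 (@inST _ x) xf) => h.
suff : 0 <= (chi2 adj e f)%:~R / 2 :> rat by rewrite pmulr_lge0 ?ler0z // invr_gt0.
apply: h; first by split=> [|w _]; [exact: inST | rewrite xf intr_int].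
split=> [w _|]; first by rewrite co0 xf ler0z.
by apply: contra fv => /eqP x0; rewrite -(intr_eq0 rat) -xf x0 co0.
Qed.

Lemma elliptic_cycle (V : {set 'I_n}) : elliptic adj e V ->
  exists g : 'I_n -> int, [/\ forall v, 0 <= g v, exists v, g v != 0,
    forall v, v \notin V -> g v = 0 & chi2 adj e g <= 0].
Proof.
move=> [_ [_ [_ [_ [x [[xV xint] [[x0 xn] chix]]]]]]].
have xi v : co x v \is a Num.int.
  by case: (boolP (v \in V)) => [/xint//|/xV ->]; rewrite rpred0.
pose g v := Num.floor (co x v).
have gx v : co x v = (g v)%:~R by rewrite floor_lat.
exists g; split.
- move=> v; rewrite floor_ge0; case: (boolP (v \in V)) => [/x0|/xV ->//].
  by rewrite co0.
- have [v xv] := vec_neq0 xn; exists v; apply: contra xv => /eqP gv.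
  by rewrite gx gv.
- by move=> v vV; rewrite /g xV // floor0.
move: chix; rewrite (chi_chi2 xV gx) => /eqP; rewrite mulf_eq0 invr_eq0 orbF.
by rewrite intr_eq0 => /eqP ->.
Qed.

Lemma elliptic_deg_sum (V : {set 'I_n}) : elliptic adj e V ->
  (deg_sum adj V + 2 = 2 * #|V|)%N /\ V != finset.set0.
Proof.
move=> [[V0 [_]]]; rewrite card_restr_rel => -> _.
by split; [move: V0; case: #|V| => //= k _; lia | rewrite -card_gt0].
Qed.

Lemma restr_dg (V : {set 'I_n}) (l f : 'I_n -> int) v :
  (forall w, w \in V -> l w = f w) -> (forall w, w \notin V -> f w = 0) ->
  v \in V -> dgz l v = dgz f v + outer_sum adj V v l.
Proof.
move=> lf f0 vV; rewrite /dg lf // -addrA; congr (_ + _).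
rewrite (bigID (mem V)) /= [in RHS](bigID (mem V)) /=.
rewrite [X in _ = _ + X + _]big1 ?addr0; last by move=> w /andP[_ /f0].
congr (_ + _); first by apply: eq_bigr => w /andP[_ /lf].
by apply: eq_bigl => w; rewrite andbC.
Qed.

Lemma outer_sum_inner (V : {set 'I_n}) v (f : 'I_n -> int) :
  (forall w, adj v w -> w \in V) -> outer_sum adj V v f = 0.
Proof. by move=> h; apply: big1 => w /andP[wV /h]; rewrite (negbTE wV). Qed.

Lemma boundary_or_inner (V : {set 'I_n}) v : v \in V ->
  v \in boundary adj T V \/ forall w, adj v w -> w \in V.
Proof.
move=> vV; case: (boolP [exists w in T :\: V, adj v w]) => h.
  by left; rewrite !inE vV.
right=> w vw; apply: contraNT h => wV; apply/existsP; exists w.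
by rewrite !inE wV vw.
Qed.

Section EndVertices.
Variable V : {set 'I_n}.
Hypothesis ends : forall v, v \in boundary adj T V -> valency adj V v = 1%N.

(** Factors at inner vertices agree. At an end-vertex each outer neighbour w adds 1 to the valency
    and l_w <= -1 to (l, E_v), so dropping them does not lower the exponent, and the remaining
    factor (1 - x)^(-1) has all coefficients 1. *)
Lemma wgt_restr_neq0 (l f : 'I_n -> int) :
  (forall w, w \in V -> l w = f w) -> (forall w, w \notin V -> f w = 0) ->
  (forall w, w \notin V -> l w < 0) ->
  wgt adj e T l != 0 -> wgt adj e V f != 0.
Proof.
move=> lf f0 lneg w0; apply/prodf_neq0 => v vV.
have lv := wexp_ge0 w0 (in_setT v).
have valE := valency_split adj V v; have dgE := restr_dg lf f0 vV.
case: (boundary_or_inner vV) => [/ends v1|inner].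
  rewrite v1 /= cfzN1 /wexp v1.
  suff -> : 0 <= 1%N%:Z - 2 + dgz f v by [].
  pose o1 := outer_sum adj V v (fun=> 1); pose ol := outer_sum adj V v l.
  have o_le0 : ol + o1 <= 0.
    by rewrite /ol /o1 -outer_sumD; apply: sumr_le0 => w /andP[/lneg]; lia.
  have : 0 <= 1%N%:Z + o1 - 2 + (dgz f v + ol).
    by move: lv; rewrite /wexp valE v1 dgE.
  by lia.
have /prodf_neq0 /(_ v (in_setT v)) := w0.
by rewrite /wexp valE dgE !outer_sum_inner // !addr0.
Qed.

(** Only factors (1 - x)^(-1) at end-vertices are shifted, so nonnegativity of the shifted exponent
    suffices. For l_v < -1, [so_max] bounds the shift below by the contribution of the outer
    neighbours in the lift [l], whose exponent at v is nonnegative. *)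
Lemma shifted_wgt_restr (tau : 'I_n -> int -> int) (l0 : {ffun 'I_n -> int}) (l : 'I_n -> int) :
  summed_out adj e V V tau -> (forall w, w \notin V -> l0 w = 0) ->
  (forall w, w \in V -> l w = l0 w) -> wgt adj e T l != 0 ->
  wgt adj e V l0 != 0 -> shifted_wgt adj e V tau l0 = wgt adj e V l0.
Proof.
move=> inv l00 ll0 wl w0; apply: eq_bigr => v vV.
have dg0 : dg_in adj e V l0 v = dgz l0 v.
  rewrite (dg_split adj e V) [outer_sum _ _ _ _]big1 ?addr0 // => w /andP[wV _].
  exact: l00.
case: (boundary_or_inner vV) => [/ends v1|inner]; last first.
  by rewrite (so_inner inv) // addr0 dg0.
rewrite /wexp v1 dg0 !cfzN1.
have := wexp_ge0 w0 vV; rewrite /wexp v1 => d1; rewrite d1.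
suff -> : 0 <= 1%N%:Z - 2 + dgz l0 v + tau v (l0 v) by [].
case: (leP (-1) (l0 v)) => l0v; first by rewrite (so_zero inv) ?addr0 //; right.
have lexp w : 2 - (valency adj T w)%:Z <= dgz l w.
  have : 0 <= (valency adj T w)%:Z - 2 + dgz l w by apply: (wexp_ge0 wl (in_setT w)).
  by lia.
pose o1 := outer_sum adj V v (fun=> 1); pose ol := outer_sum adj V v l.
have max_v : ol + o1 <= tau v (l0 v).
  rewrite /ol /o1 -outer_sumD -ll0 //; apply: (so_max inv) => //.
  by right; rewrite ll0 //; lia.
have : 2 - (1%N%:Z + o1) <= dgz l0 v + ol.
  by have := lexp v; rewrite (valency_split adj V) v1 (restr_dg ll0 l00).
by lia.
Qed.

End EndVertices.
End Extensions.

(** * The equivalence, coefficient by coefficient *)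

Theorem mainTheorem3 (n : nat) (adj : rel 'I_n) (e : 'I_n -> int)
  (V' : {set 'I_n}) (i : nat) :
  symmetric adj -> irreflexive adj ->
  elliptic adj e [set: 'I_n] ->
  elliptic adj e V' ->
  V' \proper [set: 'I_n] ->
  connected adj V' ->
  (forall v, v \in boundary adj [set: 'I_n] V' -> valency adj V' v = 1%N) ->
  is_index adj e [set: 'I_n] V' i ->
  (good_ext adj e [set: 'I_n] V' <->
   (forall l', in_lattice V' l' ->
      FiP0_sub_coef adj e [set: 'I_n] V' i l' = P0_coef adj e V' l')).
Proof.
move=> adj_sym adj_irr ellT ellV _ _ ends index.
have [[_ [connT _]] [ndT [eN2 _]]] := ellT.
have eN2' v : e v <= -2 by apply: eN2; rewrite inE.
have chi2T := elliptic_chi2_ge0 adj_sym adj_irr ndT ellT.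
have [degT _] := elliptic_deg_sum ellT; rewrite cardsT card_ord in degT.
have [degV V0] := elliptic_deg_sum ellV.
have [g [g0 gn gV cg]] := elliptic_cycle adj_sym adj_irr ndT ellV.
have BV v : v \notin V' -> v \notin NNB adj e [set: 'I_n] i.
  by case: index => _ [/fintype.subsetP BV _]; apply: contra => /BV.
have floorE (S : {set 'I_n}) (x : 'rV[rat]_n) : in_lattice S x -> forall v, co x v = (Num.floor (co x v))%:~R.
  move=> [xS xi] v; rewrite floor_lat //.
  by case: (boolP (v \in S)) => [/xi//|/xS ->]; rewrite rpred0.
have wE (S : {set 'I_n}) (x : 'rV[rat]_n) (xS : in_lattice S x) :=
  wcoef_wgt adj_sym adj_irr ndT (proj1 xS) (floorE S x xS).
have supp_restr l l' : inSupp adj e [set: 'I_n] l ->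
    (forall v, v \in [set: 'I_n] :\: NNB adj e [set: 'I_n] i -> co l v < 0) ->
    restr V' l = l' -> in_lattice V' l' -> inSupp adj e V' l'.
  move=> [latl [precl wl]] lneg ll' latl'; split=> //.
  have lE v : v \in V' -> co l v = co l' v.
    by move=> vV; rewrite -ll' /co mxE vV.
  have lneg' v : v \notin V' -> co l v < 0.
    by move=> /BV vB; apply: lneg; rewrite in_setD vB in_setT.
  split.
    move: precl; apply: contra => /forall_inP h; apply/forall_inP => v _.
    rewrite co0; case: (boolP (v \in V')) => [vV|/lneg'//].
    by have := h v vV; rewrite co0 lE.
  move: wl; rewrite !wE // !intr_eq0; apply: wgt_restr_neq0 => // v vV.
  - by rewrite lE.
  - by rewrite (proj1 latl') // floor0.
  - by rewrite -(ltrz0 rat) -(floorE _ _ latl) lneg'.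
split=> [good l' latl'|eqF l' [latl' [precl' wl']]]; last first.
  apply: contrapT => none; move/negP: wl'; apply.
  have := eqF l' latl'; rewrite /P0_coef (negbTE precl') => <-.
  rewrite /FiP0_sub_coef fsbig1 // => l [suppl [_ ll']].
  by case: none; exists l.
rewrite /P0_coef /FiP0_sub_coef.
(* If l' is not an exponent of P_0 of V', both sides vanish: by [supp_restr] the sum on the left is
   empty. *)
case: (pselect (inSupp adj e V' l')) => [suppl'|nsupp]; last first.
  rewrite fsbig1 => [|l [suppl [lneg ll']]]; last by case: nsupp; apply: supp_restr ll' latl'.
  case: ifP => // /negbT prec; apply/esym/eqP/negPn/negP => w0.
  by apply: nsupp.
have [_ [prec]] := suppl'; rewrite (negbTE prec) wE // intr_eq0 => w0.
pose l0 : {ffun 'I_n -> int} := [ffun v => Num.floor (co l' v)].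
have l0E v : (l0 v)%:~R = co l' v by rewrite ffunE -(floorE _ _ latl').
have l00 v : v \notin V' -> l0 v = 0 by move=> vV; rewrite ffunE (proj1 latl') // floor0.
have wgtE : wgt adj e V' (fun v => Num.floor (co l' v)) = wgt adj e V' l0.
  by apply: eq_bigr => v _; rewrite /wexp; congr cfz; congr (_ + _); apply: eq_dg => w; rewrite ffunE.
rewrite wgtE in w0 *.
have l0neg v : v \in V' -> v \notin NNB adj e [set: 'I_n] i -> l0 v < 0.
  by apply: (exponent_neg adj_sym adj_irr ndT connT eN2' chi2T index l00) => w; apply: wexp_ge0.
have [tau inv] := exists_summed_out adj_sym adj_irr ndT eN2' connT chi2T g0 gn gV cg V0 degV degT.
(* Goodness enters here. This lift may be nonnegative off V'; it serves through its exponent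
   inequalities. *)
have [l [[latl [_ wl]] ll']] := good _ suppl'.
have sE : shifted_wgt adj e V' tau l0 = wgt adj e V' l0.
  apply: (shifted_wgt_restr ends (l := fun v => Num.floor (co l v)) inv l00) => //.
    by move=> v vV; rewrite ffunE -ll' /co mxE vV.
  by move: wl; rewrite wE // intr_eq0.
have [|r [ur rE sumr]] := so_sum inv (l0 := l0); first by move=> v ->.
pose row (L : {ffun 'I_n -> int}) : 'rV[rat]_n := \row_v (L v)%:~R.
have rowE L v : co (row L) v = (L v)%:~R by rewrite /co mxE.
have row_lat L : in_lattice [set: 'I_n] (row L).
  by split=> [|v _]; [exact: inST | rewrite rowE intr_int].
have row_inj : injective row.
  move=> L1 L2 L12; apply/ffunP => v; apply/eqP.
  by rewrite -(eqr_int rat) -!rowE L12.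
have row_wcoef L : wcoef adj e [set: 'I_n] (row L) = (wgt adj e [set: 'I_n] L)%:~R.
  exact: (wcoef_wgt adj_sym adj_irr ndT (@inST _ (row L)) (rowE L)).
(* The terms of the truncated sum are exactly the listed extensions of [l0]: they are negative off
   V' by construction, and on V' outside B_i by [exponent_neg]. *)
rewrite (fsbig_fwiden (map row r)).
- rewrite big_map -sE -sumr rmorph_sum; apply: eq_bigr => L _; exact: row_wcoef.
- move=> x [[latx [_ wx]] [xneg xl']] /=.
  have -> : x = row [ffun v => Num.floor (co x v)].
    by apply: co_inj => v; rewrite rowE ffunE -(floorE _ _ latx).
  rewrite mem_map //; apply/rE; split; last first.
    rewrite -(intr_eq0 rat) -row_wcoef; apply: contra wx => /eqP <-; apply/eqP.
    by congr wcoef; apply: co_inj => v; rewrite rowE ffunE -(floorE _ _ latx).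
  split=> v vV; rewrite ffunE; first by rewrite ffunE -xl' /co mxE vV.
  by rewrite -(ltrz0 rat) -(floorE _ _ latx) xneg // in_setD in_setT BV.
- by rewrite map_inj_uniq.
- move=> x [/= /mapP[L /rE[[LV Lneg] wL] ->]] notA; exfalso; apply: notA.
  split; [split=> //; split|split].
  + move: prec; apply: contra => /forall_inP h; apply/forall_inP => v vV.
    by have := h v (in_setT v); rewrite !co0 rowE LV // l0E.
  + by rewrite row_wcoef intr_eq0.
  + move=> v; rewrite in_setD in_setT andbT => vB; rewrite rowE ltrz0.
    case: (boolP (v \in V')) => [vV|/Lneg//].
    by rewrite LV // l0neg.
  + apply: co_inj => v; rewrite -l0E.
    have -> : co (restr V' (row L)) v = if v \in V' then co (row L) v else 0.
      by rewrite {1}/co mxE.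
    rewrite rowE.
    by case: ifP => [vV|/negbT vV]; [rewrite LV | rewrite l00].
Qed.
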